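(* Let $F$ be a field, let $V$ be a four-dimensional vector space over $F$, and let $C$ be a plane of $\mathbb{P}(V\wedge V)$ that has no point in common with the Klein quadric $\mathcal{Q}$. Let $C^\perp$ be the polar plane of $C$ with respect to $\mathcal{Q}$ (which also has no point in common with $\mathcal{Q}$). Then the parallelisms $\parallel_C$ and $\parallel_{C^\perp}$ turn $\mathbb{P}(V)$ into a double space, i.e. for any three non-collinear points $p,q,r$ of $\mathbb{P}(V)$ the unique line through $r$ that is $C$-parallel to $p\oplus q$ has a point in common with the unique line through $q$ that is $C^\perp$-parallel to $p\oplus r$. This implies that the $F$-vector space $V$ can be made into an $F$-algebra $H:=V$ satisfying condition (A) or condition (B) such that the canonical Clifford parallelisms $\parallel_{L}$ and $\parallel_{R}$ of $\mathbb{P}(H)$ coincide with $\parallel_C$ and $\parallel_{C^\perp}$, respectively.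
   Context: Fields are commutative and of arbitrary characteristic. For a vector space $U$ over $F$, $\mathbb{P}(U)$ is the projective space of all subspaces of $U$; points, lines, planes and solids are the subspaces of vector dimension $1,2,3,4$; incidence is symmetrised inclusion. Plücker embedding: for $\dim V=4$, $\gamma$ maps a line $M$ of $\mathbb{P}(V)$ to the point $M^\gamma=F(u\wedge v)$ of $\mathbb{P}(V\wedge V)$, where $u,v$ is any basis of $M$. The Klein quadric $\mathcal{Q}$ is the image of $\gamma$. The polarity $\perp$ of the Klein quadric sends a subspace $X\subset V\wedge V$ to $X^\perp=\{y\in V\wedge V\mid x\wedge y=0 \text{ in } \bigwedge^4 V \text{ for all } x\in X\}$. A parallelism of $\mathbb{P}(V)$ is an equivalence relation on the set of lines such that each point is incident with precisely one line from each equivalence class (parallel class). For a plane $C$ of $\mathbb{P}(V\wedge V)$ having no point in common with $\mathcal{Q}$, lines $M,N$ are $C$-parallel, $M\parallel_C N$, if $C+M^\gamma=C+N^\gamma$; this relation is a parallelism. The relation $\parallel_{C^\perp}$ is defined in the same way from $C^\perp$. Conditions on an $F$-algebra $H$ (with $F$ identified with $F\cdot 1_H$): (A) $H$ is a quaternion skew field with centre $F$ (so $[H:F]=4$); (B) $H$ is an extension field of $F$ with $[H:F]=4$ and $h^2\in F$ for all $h\in H$. For such $H$, lines $M,N$ of $\mathbb{P}(H)$ (two-dimensional $F$-subspaces) are left parallel, $M\parallel_L N$, if $cM=N$ for some $c\in H\setminus\{0\}$, and right parallel, $M\parallel_R N$, if $Mc=N$ for some $c\in H\setminus\{0\}$.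 These two parallelisms are the canonical Clifford parallelisms of $\mathbb{P}(H)$. *)

(* Defs.v *)
From HB Require Import structures.
From mathcomp Require Import all_boot all_order all_algebra all_field.

Set Implicit Arguments.
Unset Strict Implicit.
Unset Printing Implicit Defensive.

Import GRing.Theory.
Local Open Scope ring_scope.

(* The exterior algebra of F^n in the standard monomial basis: the subset
   S = {i_1 < ... < i_k} of 'I_n indexes the coordinate along
   e_{i_1} /\ ... /\ e_{i_k}. *)
Definition extalg (F : fieldType) (n : nat) := {ffun {set 'I_n} -> F^o}.

Section ExteriorAlgebra.
Variables (F : fieldType) (n : nat).
Implicit Types (A B C S : {set 'I_n}) (i j : 'I_n) (x y z : extalg F n).

HB.instance Definition _ := Vector.copy (extalg F n) {ffun {set 'I_n} -> F^o}.

(* e_A /\ e_B = (-1)^(ext_inv A B) e_(A :|: B) for disjoint A and B. *)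
Definition ext_inv A B : nat := \sum_(i in A) \sum_(j in B) (j < i)%N.

Definition ext_mul x y : extalg F n :=
  [ffun S : {set 'I_n} => \sum_(A : {set 'I_n} | A \subset S)
               (-1) ^+ ext_inv A (S :\: A) * (x A : F) * (y (S :\: A) : F)].

Definition ext_mon A : extalg F n := [ffun S : {set 'I_n} => (S == A)%:R].

Let sum_setU (f : 'I_n -> nat) A B : [disjoint A & B] ->
  (\sum_(i in A :|: B) f i = \sum_(i in A) f i + \sum_(i in B) f i)%N.
Proof.
move=> dAB; rewrite -bigU //=; apply: eq_bigl => i.
by rewrite !inE.
Qed.

Lemma ext_invUl A B C :
  [disjoint A & B] -> ext_inv (A :|: B) C = (ext_inv A C + ext_inv B C)%N.
Proof. by move=> dAB; apply: sum_setU. Qed.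

Lemma ext_invUr A B C :
  [disjoint B & C] -> ext_inv A (B :|: C) = (ext_inv A B + ext_inv A C)%N.
Proof.
move=> dBC; rewrite /ext_inv -big_split /=; apply: eq_bigr => i _.
exact: sum_setU.
Qed.

Lemma ext_inv_assoc A B S : A \subset B -> B \subset S ->
  (ext_inv B (S :\: B) + ext_inv A (B :\: A) =
   ext_inv A (S :\: A) + ext_inv (B :\: A) (S :\: B))%N.
Proof.
move=> sAB sBS.
have d1 : [disjoint A & B :\: A].
  by rewrite -setI_eq0; apply/eqP/setP => i; rewrite !inE; case: (i \in A).
have d2 : [disjoint B :\: A & S :\: B].
  by rewrite -setI_eq0; apply/eqP/setP => i; rewrite !inE; case: (i \in B); rewrite ?andbF.
have -> : ext_inv B (S :\: B) = ext_inv (A :|: (B :\: A)) (S :\: B).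
  by congr ext_inv; rewrite setDE setUIr setUCr setIT (setUidPr sAB).
have -> : S :\: A = (B :\: A) :|: (S :\: B).
  apply/setP => i; rewrite !inE.
  have := subsetP sAB i; have := subsetP sBS i.
  case: (i \in A); case: (i \in B); case: (i \in S) => //= H1 H2;
    by [move: (H1 isT) | move: (H2 isT)].
by rewrite ext_invUl // ext_invUr // addnC addnA.
Qed.

Lemma ext_mulA : associative ext_mul.
Proof.
move=> x y z; apply/ffunP => S; rewrite !ffunE.
under [RHS]eq_bigr => B sB do rewrite ffunE mulr_sumr mulr_suml.
rewrite [RHS](exchange_big_dep (fun A => A \subset S)) /=; last first.
  by move=> B A sBS sAB; apply: subset_trans sBS.
apply: eq_bigr => A sAS; rewrite ffunE mulr_sumr.
rewrite (reindex_onto (fun B : {set 'I_n} => B :\: A) (fun D => A :|: D)) /=; last first.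
  move=> D /subsetP sD; apply/setP => i; rewrite !inE.
  by have := sD i; rewrite !inE; case: (i \in A) => //=; case: (i \in D) => // /(_ isT).
apply: eq_big => [B | B].
  apply/andP/andP => [[sBA /eqP eB] | [sBS sAB]].
    have sAB : A \subset B by rewrite -eB subsetUl.
    split=> //; apply/subsetP => i Bi; case Ai: (i \in A); first exact: (subsetP sAS).
    have : i \in B :\: A by rewrite inE Ai Bi.
    by move/(subsetP sBA); rewrite inE => /andP[].
  split; first exact: setSD.
  by apply/eqP; rewrite setDE setUIr setUCr setIT (setUidPr sAB).
move=> /andP[sBA /eqP eB].
have sAB : A \subset B by rewrite -eB subsetUl.
have sBS : B \subset S.
  apply/subsetP => i Bi; case Ai: (i \in A); first exact: (subsetP sAS).
  have : i \in B :\: A by rewrite inE Ai Bi.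
  by move/(subsetP sBA); rewrite inE => /andP[].
have eD : (S :\: A) :\: (B :\: A) = S :\: B.
  apply/setP => i; rewrite !inE; have := subsetP sAB i.
  by case: (i \in A); case: (i \in B); case: (i \in S) => // /(_ isT).
rewrite eD.
have eqs : (-1) ^+ ext_inv B (S :\: B) * (-1) ^+ ext_inv A (B :\: A) =
   (-1) ^+ ext_inv A (S :\: A) * (-1) ^+ ext_inv (B :\: A) (S :\: B) :> F.
  by rewrite -!exprD ext_inv_assoc.
rewrite !mulrA; congr (_ * _); congr (_ * _); rewrite eqs -!mulrA; congr (_ * _).
by rewrite mulrC.
Qed.

Lemma ext_mul1l : left_id (ext_mon set0) ext_mul.
Proof.
move=> x; apply/ffunP => S; rewrite !ffunE (bigD1 set0) ?sub0set //=.
rewrite setD0 /ext_inv big_set0 ffunE eqxx expr0 !mul1r big1 ?addr0 // => A.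
by case/andP=> _ /negPf A0; rewrite ffunE A0 mulr0 mul0r.
Qed.

Lemma ext_mul1r : right_id (ext_mon set0) ext_mul.
Proof.
move=> x; apply/ffunP => S; rewrite !ffunE (bigD1 S) //=.
rewrite setDv ffunE eqxx mulr1 big1 ?addr0 => [|A /andP[sAS neA]].
  by rewrite /ext_inv big1 ?expr0 ?mul1r // => i _; rewrite big_set0.
rewrite ffunE setD_eq0; have [sSA|_] := boolP (S \subset A); last by rewrite mulr0.
by rewrite eqEsubset sAS sSA in neA.
Qed.

Lemma ext_mulDl : left_distributive ext_mul +%R.
Proof.
move=> x y z; apply/ffunP => S; rewrite !ffunE -big_split /=.
by apply: eq_bigr => A _; rewrite ffunE mulrDr mulrDl.
Qed.

Lemma ext_mulDr : right_distributive ext_mul +%R.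
Proof.
move=> x y z; apply/ffunP => S; rewrite !ffunE -big_split /=.
by apply: eq_bigr => A _; rewrite ffunE mulrDr.
Qed.

Lemma ext_mon_neq0 A : ext_mon A != 0.
Proof.
by apply/eqP => /ffunP/(_ A) /eqP; rewrite !ffunE eqxx oner_eq0.
Qed.

HB.instance Definition _ := GRing.Zmodule_isNzRing.Build (extalg F n)
  ext_mulA ext_mul1l ext_mul1r ext_mulDl ext_mulDr (ext_mon_neq0 set0).

Lemma ext_scaleAl (a : F) x y : a *: (x * y) = (a *: x) * y.
Proof.
apply/ffunP => S; rewrite !ffunE [LHS]mulr_sumr; apply: eq_bigr => A _.
by rewrite !ffunE /= !mulrA [a * _]mulrC.
Qed.

HB.instance Definition _ := GRing.Lmodule_isLalgebra.Build F (extalg F n)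
  ext_scaleAl.

Lemma ext_scaleAr (a : F) x y : a *: (x * y) = x * (a *: y).
Proof.
apply/ffunP => S; rewrite !ffunE [LHS]mulr_sumr; apply: eq_bigr => A _.
by rewrite !ffunE /= mulrCA.
Qed.

HB.instance Definition _ := GRing.Lalgebra_isAlgebra.Build F (extalg F n)
  ext_scaleAr.
HB.instance Definition _ := Algebra_isFalgebra.Build F (extalg F n).

Lemma ext_monU A B : [disjoint A & B] ->
  ext_mon A * ext_mon B = (-1) ^+ ext_inv A B *: ext_mon (A :|: B) :> extalg F n.
Proof.
move=> dAB; apply/ffunP => S; rewrite ffunE /=.
have eDU : (A :|: B) :\: A = B.
  by rewrite setDUl setDv set0U; apply/setDidPl; rewrite disjoint_sym.
have mon_sum x : \sum_(C : {set 'I_n} | C \subset S) (-1) ^+ ext_inv C (S :\: C)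
      * (ext_mon A C : F) * (x (S :\: C) : F)
    = (if A \subset S then (-1) ^+ ext_inv A (S :\: A) * (x (S :\: A) : F) else 0).
  rewrite big_mkcond (bigD1 A) //= big1 ?addr0 => [|C /negPf nC].
    by rewrite ffunE eqxx mulr1.
  by rewrite ffunE nC mulr0 mul0r if_same.
rewrite mon_sum !ffunE; case: ifP => [sAS|nAS].
  have [/eqP eB|nB] := boolP (S :\: A == B).
    have -> : S = A :|: B by rewrite -eB setDE setUIr setUCr setIT; apply/esym/setUidPr.
    by rewrite eDU eqxx.
  case: eqP => [eS|_]; last by rewrite mulr0 scaler0.
  by rewrite eS eDU eqxx in nB.
case: eqP => [eS|_]; last by rewrite scaler0.
by rewrite eS subsetUl in nAS.
Qed.

Lemma ext_mon1_sqr i : ext_mon [set i] * ext_mon [set i] = 0 :> extalg F n.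
Proof.
apply/ffunP => S; rewrite !ffunE big1 // => A _; rewrite !ffunE.
case: eqP => [->|_]; last by rewrite mulr0 mul0r.
case: eqP => [eS|_]; last by rewrite mulr0.
by move/setP/(_ i): eS; rewrite !inE eqxx.
Qed.

Lemma ext_monM i j : ext_mon [set i] * ext_mon [set j] =
  (if i == j then 0 else (-1) ^+ (j < i)%N *: ext_mon [set i; j]) :> extalg F n.
Proof.
case: (eqVneq i j) => [->|nij]; first exact: ext_mon1_sqr.
by rewrite ext_monU ?disjoints1 ?inE // /ext_inv !big_set1.
Qed.

End ExteriorAlgebra.

(* The exterior algebra of V, written in the basis vbasis {:V}; any other basis
   gives a canonically isomorphic algebra. *)
Definition exterior (F : fieldType) (V : vectType F) := extalg F (\dim {:V}).

Section Exterior.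
Variables (F : fieldType) (V : vectType F).

HB.instance Definition _ :=
  Falgebra.copy (exterior V) (extalg F (\dim {:V})).

Definition ext_vec (v : V) : exterior V :=
  \sum_i coord (vbasis {:V}) i v *: ext_mon F [set i].

Fact ext_vec_is_linear : linear ext_vec.
Proof.
move=> a u v; rewrite /ext_vec scaler_sumr -big_split /=.
by apply: eq_bigr => i _; rewrite linearP scalerDl scalerA.
Qed.

HB.instance Definition _ := GRing.isLinear.Build F V (exterior V) _ ext_vec
  ext_vec_is_linear.

Definition ext_in : 'Hom(V, exterior V) := linfun ext_vec.

Definition ext_pow (k : nat) : {vspace exterior V} := (limg ext_in ^+ k)%VS.

Lemma ext_in_sqr (v : V) : ext_in v * ext_in v = 0.
Proof.
rewrite lfunE /= /ext_vec mulr_suml.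
under eq_bigr => i _ do rewrite mulr_sumr.
rewrite pair_big /= (bigID (fun p : 'I_(\dim {:V}) * 'I_(\dim {:V}) => p.1 < p.2)%N) /=.
rewrite [X in _ + X](bigID (fun p : 'I_(\dim {:V}) * 'I_(\dim {:V}) => p.1 == p.2)) /= addrC.
rewrite [X in X + _ + _]big1 ?add0r; last first.
  case=> i j /= /andP[_ /eqP->].
  by rewrite -scalerAl -scalerAr ext_monM eqxx !scaler0.
rewrite (reindex_inj (h := fun p : 'I_(\dim {:V}) * 'I_(\dim {:V}) => (p.2, p.1))) /=; last first.
  by case=> ? ? [? ?] [-> ->].
rewrite (eq_bigl (fun p : 'I_(\dim {:V}) * 'I_(\dim {:V}) => p.1 < p.2)%N) => [|[i j]] /=; last first.
  by rewrite -leqNgt [RHS]ltn_neqAle andbC eq_sym.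
rewrite -big_split /= big1 // => -[i j] /= ltij.
rewrite -!scalerAl -!scalerAr !ext_monM.
have nij : (i == j) = false by apply: ltn_eqF.
rewrite [j == i]eq_sym nij ltij ltnNge (ltnW ltij) /= setUC expr0 expr1 scale1r.
by rewrite scaleN1r !scalerA mulrC scalerN addNr.
Qed.

Lemma ext_inC (u v : V) : ext_in v * ext_in u = - (ext_in u * ext_in v).
Proof.
apply/eqP; rewrite -addr_eq0; have := ext_in_sqr (v + u).
by rewrite linearD mulrDl !mulrDr !ext_in_sqr add0r addr0 => ->.
Qed.

Lemma dim_exterior : \dim {:exterior V} = (2 ^ \dim {:V})%N.
Proof. by rewrite dimvf /dim /= muln1 -cardsT -powersetT card_powerset cardsT card_ord. Qed.

End Exterior.

Section ProjectiveSpace.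
Variables (F : fieldType) (U : vectType F).
Implicit Types (p q r L M N X : {vspace U}).

(* The projective space P(U) is {vspace U}, with vector dimensions. *)
Definition point X := \dim X = 1%N.
Definition line X := \dim X = 2%N.
Definition plane X := \dim X = 3%N.

Definition collinear p q r :=
  exists L, [/\ line L, (p <= L)%VS, (q <= L)%VS & (r <= L)%VS].

Definition parallelism (par : {vspace U} -> {vspace U} -> Prop) :=
  [/\ forall M, line M -> par M M,
      forall M N, line M -> line N -> par M N -> par N M,
      forall L M N, line L -> line M -> line N ->
        par L M -> par M N -> par L N
    & forall p M, point p -> line M ->
        exists! N, [/\ line N, (p <= N)%VS & par N M]].

Definition double_space (par1 par2 : {vspace U} -> {vspace U} -> Prop) :=
  [/\ parallelism par1, parallelism par2
    & forall p q r, point p -> point q -> point r -> ~ collinear p q r ->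
      exists M N,
        [/\ unique (fun M' => [/\ line M', (r <= M')%VS & par1 M' (p + q)%VS]) M,
            unique (fun N' => [/\ line N', (q <= N')%VS & par2 N' (p + r)%VS]) N
          & exists s, [/\ point s, (s <= M)%VS & (s <= N)%VS]]].

End ProjectiveSpace.

Section Klein.
Variables (F : fieldType) (V : vectType F).
Implicit Types (M N : {vspace V}) (C X Y : {vspace exterior V}).

(* Only meaningful on lines M; independent of the chosen basis by pluckerE. *)
Definition plucker M : {vspace exterior V} :=
  <[ext_in V (vbasis M)`_0 * ext_in V (vbasis M)`_1]>%VS.

Lemma pluckerE M (u v : V) : basis_of M [:: u; v] ->
  plucker M = <[ext_in V u * ext_in V v]>%VS.
Proof.
move=> bM; have dM : \dim M = 2%N.
  by rewrite -(span_basis bM); apply/eqP; apply: basis_free bM.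
have wedge_sub (u1 v1 u2 v2 : V) : u2 \in <<[:: u1; v1]>>%VS ->
    v2 \in <<[:: u1; v1]>>%VS ->
    (<[ext_in V u2 * ext_in V v2]> <= <[ext_in V u1 * ext_in V v1]>)%VS.
  rewrite !span_cons span_nil addv0.
  case/memv_addP=> _ /vlineP[a ->] [_ /vlineP[b ->] ->].
  case/memv_addP=> _ /vlineP[c ->] [_ /vlineP[d ->] ->].
  rewrite !linearD !linearZ mulrDl !mulrDr -!scalerAl -!scalerAr !ext_in_sqr.
  rewrite !scaler0 add0r addr0 [ext_in V v1 * _]ext_inC !scalerN !scalerA -scalerBl.
  by rewrite -memvE memvZ // memv_line.
have sM : << [:: (vbasis M)`_0; (vbasis M)`_1] >>%VS = M.
  rewrite -[RHS](span_basis (vbasisP M)); congr (<< _ >>%VS).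
  have sz : size (vbasis M) = 2%N by rewrite size_tuple.
  by case: (tval _) sz => [|x [|y []]].
have vM k : (vbasis M)`_k \in M.
  have [ltk|gek] := ltnP k (size (vbasis M)); last by rewrite nth_default ?mem0v.
  exact/vbasis_mem/mem_nth.
have uM : u \in M by apply: (basis_mem bM); rewrite inE eqxx.
have wM : v \in M by apply: (basis_mem bM); rewrite !inE eqxx orbT.
by apply/eqP; rewrite eqEsubv !wedge_sub // ?sM ?(span_basis bM).
Qed.

Definition klein_quadric X := exists2 M, line M & X = plucker M.

Definition external C := ~ exists2 X, klein_quadric X & (X <= C)%VS.

Definition polar X : {vspace exterior V} :=
  (ext_pow V 2 :&: \bigcap_(x <- vbasis X) lker (amull x))%VS.

Lemma polarP X y :
  reflect (y \in ext_pow V 2 /\ forall x, x \in X -> x * y = 0) (y \in polar X).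
Proof.
rewrite memv_cap; apply: (iffP andP) => -[y2 Xy]; split=> //.
  move=> x /coord_vbasis->; rewrite mulr_suml big1 // => i _.
  move: Xy; rewrite -scalerAl (big_rem (tnth (vbasis X) i)) ?mem_tnth //=.
  rewrite memv_cap => /andP[+ _]; rewrite memv_ker lfunE /= => /eqP.
  by rewrite -tnth_nth => ->; rewrite scaler0.
rewrite big_seq; elim/big_rec: _ => [|x Y /vbasis_mem xX yY]; first exact: memvf.
by rewrite memv_cap yY andbT memv_ker lfunE /= Xy.
Qed.

Definition klein_parallel C M N := (C + plucker M = C + plucker N)%VS.

End Klein.

Record alg_struct (F : fieldType) (V : vectType F) := AlgStruct {
  alg_mul : V -> V -> V;
  alg_one : V;
  alg_mulA : associative alg_mul;
  alg_mul1l : left_id alg_one alg_mul;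
  alg_mul1r : right_id alg_one alg_mul;
  alg_mulDl : left_distributive alg_mul +%R;
  alg_mulDr : right_distributive alg_mul +%R;
  alg_scaleAl : forall (a : F) u v, a *: alg_mul u v = alg_mul (a *: u) v;
  alg_scaleAr : forall (a : F) u v, a *: alg_mul u v = alg_mul u (a *: v);
  alg_one_neq0 : alg_one != 0
}.

Definition alg_of (F : fieldType) (V : vectType F) (S : alg_struct V) : Type := V.

Section AlgOf.
Variables (F : fieldType) (V : vectType F) (S : alg_struct V).

HB.instance Definition _ := Vector.copy (alg_of S) V.
HB.instance Definition _ := GRing.Zmodule_isNzRing.Build (alg_of S)
  (alg_mulA S) (alg_mul1l S) (alg_mul1r S) (alg_mulDl S) (alg_mulDr S)
  (alg_one_neq0 S).
HB.instance Definition _ := GRing.Lmodule_isLalgebra.Build F (alg_of S)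
  (alg_scaleAl S).
HB.instance Definition _ := GRing.Lalgebra_isAlgebra.Build F (alg_of S)
  (alg_scaleAr S).
HB.instance Definition _ := Algebra_isFalgebra.Build F (alg_of S).

Definition alg_carrier (v : V) : alg_of S := v.

Fact alg_carrier_is_linear : linear alg_carrier. Proof. by []. Qed.

HB.instance Definition _ := GRing.isLinear.Build F V (alg_of S) _ alg_carrier
  alg_carrier_is_linear.

(* The identity map of V, needed only because the subspace types of V and of
   alg_of S are not convertible. *)
Definition alg_id : 'Hom(V, alg_of S) := linfun alg_carrier.

Lemma alg_idE (v : V) : alg_id v = v. Proof. exact: lfunE. Qed.

Lemma alg_mulE (u v : V) : alg_id u * alg_id v = alg_mul S u v.
Proof. by rewrite !alg_idE. Qed.

End AlgOf.

Section Clifford.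
Variables (F : fieldType) (H : falgType F).
Implicit Types (M N : {vspace H}).

(* Presentation valid in every characteristic: 1, i span the separable quadratic
   algebra F[t]/(t^2 - t - a), and j induces its conjugation t |-> 1 - t.  When
   2 != 0, i0 := 2i - 1 gives the usual i0^2 = 4a + 1, j^2 = b, j i0 = - i0 j. *)
Definition quaternion_algebra :=
  exists (i j : H) (a b : F),
    [/\ basis_of {:H} [:: 1; i; j; i * j], 1 + 4%:R * a != 0, b != 0
      & [/\ i ^+ 2 = i + a%:A, j ^+ 2 = b%:A & j * i = (1 - i) * j]].

Definition skew_field := forall h : H, h != 0 -> h \is a GRing.unit.

Definition condition_A :=
  [/\ quaternion_algebra, skew_field & 'Z({:H})%VS = 1%VS].

Definition condition_B :=
  [/\ (forall h k : H, h * k = k * h), skew_field, \dim {:H} = 4%N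
    & forall h : H, h ^+ 2 \in 1%VS].

(* amull c and amulr c are h |-> c * h and h |-> h * c. *)
Definition left_parallel M N := exists2 c : H, c != 0 & (amull c @: M)%VS = N.
Definition right_parallel M N := exists2 c : H, c != 0 & (amulr c @: M)%VS = N.

End Clifford.

(* Main.v *)
Require Import Defs.
From HB Require Import structures.
From mathcomp Require Import all_boot all_order all_algebra all_field.
From mathcomp Require Import ring.

Set Implicit Arguments.
Unset Strict Implicit.
Unset Printing Implicit Defensive.

(** The even Clifford algebra of the Klein quadratic form carries the theorem.

A bivector w gives an alternating form on V (pair u and v to the coefficient of
w /\ u /\ v in the top exterior power) and, dually, an alternating form on the
dual space.  As maps V -> V* and V* -> V these two compose, in either order, to
multiplication by the Klein form Q(w): V (+) V* is the spin module of Q, and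
bivectors that are orthogonal for the polarity anticommute on it
([kform_dual], [kform_dualD]).  Q vanishes exactly on the decomposable
bivectors, so the plane C misses the Klein quadric iff Q is anisotropic on C.

For such a C let E(C) be the 4-dimensional space of operators on V spanned by 1
and the products of two elements of C, the even Clifford algebra of Q on C.
In dimension three every even element is a product of two vectors, so every
nonzero operator in E(C) is invertible ([even_op_factor]); hence an operator of
E(C) is determined by the image of one nonzero vector, which can be any vector.
Let D be the polar plane of C.  Elements of C and D anticommute, with two
consequences.  The operators of E(C) commute with those of E(D)
([even_op_comm]).  A nonzero operator of E(C) multiplies all forms from D by
one common factor ([even_op_similitude]); as C = D^perp, it therefore maps each
line to a C-parallel line ([klein_parallel_even_op]).  A bivector u /\ v that
lies in C vanishes, so C-parallel lines with a common point coincide, and the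
C-parallel class of a line is exactly its orbit under E(C)
([klein_parallel_orbit]).

The double space axiom is now the commutation of E(C) and E(D): if S in E(C)
maps p to r and T in E(D) maps p to q, the required common point is the image
of p under ST = TS ([klein_double_space]).

For the algebra, fix e != 0 and let x y be the image of y under the operator of
E(C) that maps e to x.  By commutation this is also the image of x under the
operator of E(D) that maps e to y ([klein_mulE]), so left multiplications form
E(C), right multiplications form E(D), and associativity is once more their
commutation.  Left and right parallelism are orbit equivalence under E(C) and
E(D).  The resulting division algebra has dimension 4 and all its elements are
quadratic over F, which forces condition (A) or condition (B)
([quadratic_division_algebra]). *)

Import GRing.Theory.
Local Open Scope ring_scope.

Local Notation ord3 k := (@Ordinal 3 k isT).
Local Notation ord4 k := (@Ordinal 4 k isT).
Local Notation ord6 k := (@Ordinal 6 k isT).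

(** * Division algebras whose elements are quadratic *)

Section QuadraticDivisionAlgebra.
Variables (F : fieldType) (H : falgType F).
Hypothesis skewH : skew_field H.
Implicit Types (h k x y : H).

Lemma skew_mul_eq0 x y : x * y = 0 -> x = 0 \/ y = 0.
Proof.
have [->|x0] := eqVneq x 0; first by left.
by move=> xy0; right; apply: (mulrI (skewH x0)); rewrite mulr0.
Qed.

Definition quadratic_algebra := forall h : H, exists t n : F, h ^+ 2 = t *: h + n%:A.

Section Plane.
Variables (i : H) (a : F).
Hypotheses (i2 : i ^+ 2 = i + a%:A) (iN1 : i \notin 1%VS).

(** The commutative subalgebra F[i], written on its basis 1, i. *)
Definition lin1i (p q : F) : H := p%:A + q *: i.

Lemma lin1iM p q r s :
  lin1i p q * lin1i r s = lin1i (p * r + q * s * a) (p * s + q * r + q * s).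
Proof.
rewrite /lin1i mulrDl !mulrDr -!scalerAl -!scalerAr !mul1r !mulr1 -expr2 i2.
rewrite !scalerDr !scalerA !scalerDl -!addrA; congr (_ + _).
by rewrite !addrA [LHS]addrC !addrA.
Qed.

Lemma lin1iB p q r s : lin1i p q - lin1i r s = lin1i (p - r) (q - s).
Proof. by rewrite /lin1i opprD addrACA !scalerBl. Qed.

Lemma lin1i_scalar p : lin1i p 0 = p%:A. Proof. by rewrite /lin1i scale0r addr0. Qed.

Lemma lin1i_eq0 p q : lin1i p q = 0 -> p = 0 /\ q = 0.
Proof.
have [-> |q0] := eqVneq q 0.
  rewrite lin1i_scalar => /eqP; rewrite scaler_eq0 oner_eq0 orbF.
  by move/eqP=> ->.
move=> zpq; case/negP: iN1; have -> : i = (- (q^-1 * p))%:A.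
  apply: (scalerI q0); rewrite scalerA mulrN mulVKf // scaleNr.
  by apply/eqP; rewrite -addr_eq0 addrC; apply/eqP.
by rewrite memvZ // memv_line.
Qed.

(** F[i] is closed under division: the conjugate of p + q i is (p + q) - q i, and
the product N of the two is a nonzero scalar. *)
Lemma lin1i_div p q r s k : lin1i p q != 0 -> lin1i p q * k = lin1i r s ->
  exists p' q', k = lin1i p' q'.
Proof.
move=> z0 zk; set N := p * (p + q) - q * q * a.
have zN : lin1i (p + q) (- q) * lin1i p q = N%:A.
  by rewrite lin1iM -lin1i_scalar /N; congr lin1i; ring.
have N0 : N != 0.
  apply/eqP => N0; move: zN; rewrite N0 scale0r => /skew_mul_eq0[]; last first.
    by move/eqP: z0.
  case/lin1i_eq0=> pq /eqP; rewrite oppr_eq0 => /eqP q0.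
  by move: z0; rewrite -[p]addr0 -{1}q0 pq q0 /lin1i !scale0r addr0 eqxx.
exists (N^-1 * ((p + q) * r + - q * s * a)),
  (N^-1 * ((p + q) * s + - q * r + - q * s)).
apply: (scalerI N0); rewrite -[in LHS](mul1r k) scalerAl -zN -[LHS]mulrA zk lin1iM.
by rewrite /lin1i scalerDr !scalerA !mulVKf.
Qed.

(** A commuting k makes both k and i k quadratic, and comparing (i k)^2 with
i^2 k^2 gives an equation beta k = alpha with alpha, beta in F[i].  If
beta = 0, then k^2 is a scalar multiple of k, so k is a scalar. *)
Lemma centraliser_quadratic_plane k : quadratic_algebra -> k * i = i * k ->
  exists p q, k = lin1i p q.
Proof.
move=> quad ki.
have [t [n k2]] := quad k; have [s [m ik2]] := quad (i * k).
have E1 : (i * k) ^+ 2 = i ^+ 2 * k ^+ 2.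
  by rewrite !expr2 mulrA -(mulrA i k i) ki !mulrA.
have E2 : lin1i (a * t - 0) (t - s) * k = lin1i (m - a * n) (0 - n).
  rewrite -!lin1iB mulrBl; apply/eqP; rewrite subr_eq addrAC eq_sym subr_eq.
  have -> : lin1i 0 s = s *: i by rewrite /lin1i scale0r add0r.
  rewrite -scalerAl lin1i_scalar addrC -ik2 E1 i2 k2.
  have -> : i + a%:A = lin1i a 1 by rewrite /lin1i scale1r addrC.
  have -> : t *: k = lin1i t 0 * k by rewrite lin1i_scalar mulr_algl.
  by rewrite mulrDr mulrA -lin1i_scalar !lin1iM !mulr0 !mul0r !mul1r !addr0 !add0r.
have [z0|z0] := eqVneq (lin1i (a * t - 0) (t - s)) 0; last exact: lin1i_div z0 E2.
move/esym: E2; rewrite z0 mul0r => /lin1i_eq0[_]; rewrite sub0r => /eqP.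
rewrite oppr_eq0 => /eqP n0; move: k2; rewrite n0 scale0r addr0 => /eqP.
rewrite -subr_eq0 expr2 -[t *: k]mulr_algl -mulrBl => /eqP.
case/skew_mul_eq0 => [/eqP|->]; last by exists 0, 0; rewrite /lin1i !scale0r addr0.
by rewrite subr_eq0 => /eqP->; exists t, 0; rewrite lin1i_scalar.
Qed.

(** The two relations give (1 - 2 i) x = 0, and 1 - 2 i is nonzero in every
characteristic because i is not a scalar. *)
Lemma conj_commute_eq0 x : x * i = (1 - i) * x -> x * i = i * x -> x = 0.
Proof.
move=> xi1 xi2; have : (1 - i *+ 2) * x = 0.
  by rewrite mulr2n opprD addrA mulrBl -xi1 xi2 subrr.
case/skew_mul_eq0 => // /eqP; rewrite subr_eq0 -scaler_nat => /eqP e.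
case/negP: iN1; have [two|two] := eqVneq (2%:R : F) 0.
  by move/eqP: e; rewrite two scale0r oner_eq0.
by rewrite -[i](scalerK two) -e memvZ // memv_line.
Qed.

(** An element j that induces the conjugation of F[i] is independent of F[i], and
j^2 commutes with i; if j^2 = t j + b had t != 0, then j would commute with i.
A central element lies in the centraliser F[i] of i, and commuting with j
removes its i-component. *)
Lemma conj_comm_quaternion (j : H) : quadratic_algebra -> \dim {:H} = 4%N ->
  j != 0 -> j * i = (1 - i) * j -> condition_A H.
Proof.
move=> quad dimH j0 ji.
have jNi : j * i <> i * j by move/(conj_commute_eq0 ji)/eqP; exact/negP.
have jN_plane p q : j <> lin1i p q.
  by move=> jE; apply: jNi; rewrite jE /lin1i mulrDl mulrDr -!scalerAl -!scalerAr mul1r mulr1.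
have free4 p q r s : p%:A + q *: i + r *: j + s *: (i * j) = 0 ->
    [/\ p = 0, q = 0, r = 0 & s = 0].
  have -> : p%:A + q *: i + r *: j + s *: (i * j) = lin1i p q + lin1i r s * j.
    by rewrite [lin1i r s]/lin1i mulrDl -!scalerAl mul1r !addrA.
  have [z0|z0] := eqVneq (lin1i r s) 0.
    by rewrite z0 mul0r addr0 => /lin1i_eq0[-> ->]; case/lin1i_eq0: z0 => -> ->.
  move/eqP; rewrite addrC addr_eq0 => /eqP zj; case: (@lin1i_div r s (- p) (- q) j) => //.
    by rewrite zj /lin1i opprD !scaleNr.
  by move=> p' [q' /jN_plane].
have j2i : j ^+ 2 * i = i * j ^+ 2.
  rewrite expr2 -[LHS]mulrA ji [LHS]mulrA mulrBr mulr1 ji [(1 - i) * j]mulrBl.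
  by rewrite mul1r opprB addrCA subrr addr0 mulrA.
have [t [b j2]] := quad j.
have t0 : t = 0.
  apply/eqP; apply/negP => /negP t0; apply: jNi; apply: (scalerI t0).
  rewrite scalerAl scalerAr.
  have -> : t *: j = j ^+ 2 - b%:A by rewrite j2 addrK.
  by rewrite mulrBl mulrBr j2i -scalerAl -scalerAr mul1r mulr1.
rewrite t0 scale0r add0r in j2.
have centre z : (forall h, z * h = h * z) -> z \in 1%VS.
  move=> zC; have [p [q zE]] := centraliser_quadratic_plane quad (zC i).
  suff q0 : q = 0 by rewrite zE q0 lin1i_scalar memvZ // memv_line.
  apply/eqP; apply/negP => /negP q0; apply: jNi; apply: (scalerI q0).
  have qi : q *: i = z - p%:A by rewrite zE /lin1i addrC addKr.
  by rewrite scalerAr qi scalerAl qi mulrBl mulrBr zC mulr_algl mulr_algr.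
split=> //.
  have dim1 : size [:: 1; i; j; i * j] = \dim {:H} by rewrite dimH.
  exists i, j, a, b; split.
  - rewrite basisEfree subvf dim1 leqnn andbT andbT.
    pose X : 4.-tuple H := [tuple 1; i; j; i * j].
    apply/(@freeP _ _ _ X) => k.
    rewrite !big_ord_recl big_ord0 addr0 /= !addrA => /free4[k0 k1 k2 k3].
    case=> [[|[|[|[|//]]]] ltu]; [rewrite -[RHS]k0 | rewrite -[RHS]k1
      | rewrite -[RHS]k2 | rewrite -[RHS]k3]; congr (k _); exact: val_inj.
  - apply/eqP => a0; suff [/eqP] : (1 : F) = 0 /\ - 2%:R = 0 :> F by rewrite oner_eq0.
    (* 1 + 4 a is the square of 1 - 2 i. *)
    suff : lin1i 1 (- 2%:R) * lin1i 1 (- 2%:R) = 0 by case/skew_mul_eq0=> /lin1i_eq0.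
    rewrite lin1iM -(_ : lin1i 0 0 = 0); last by rewrite /lin1i !scale0r addr0.
    by congr lin1i; [rewrite -[RHS]a0 |]; ring.
  - apply/eqP => b0; move: j2; rewrite b0 scale0r expr2.
    by case/skew_mul_eq0 => /eqP; exact/negP.
  - by split.
apply/eqP; rewrite eqEsubv; apply/andP; split; apply/subvP => z.
  case/memv_capP=> _ /centvP zC; apply: centre => h; apply: zC; exact: memvf.
case/vlineP=> q ->; rewrite memv_cap memvf; apply/centvP => h _.
by rewrite mulr_algl mulr_algr.
Qed.
End Plane.

Hypotheses (quad : quadratic_algebra) (dimH : \dim {:H} = 4%N).

Lemma unital_quadratic h (t n : F) :
  h ^+ 2 = t *: h + n%:A -> t != 0 -> h \notin 1%VS ->
  exists (i : H) (a : F), i ^+ 2 = i + a%:A /\ i \notin 1%VS.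
Proof.
move=> h2 t0 hN1; exists (t^-1 *: h), (t^-1 * t^-1 * n); split.
  by rewrite exprZn h2 expr2 scalerDr !scalerA mulfVK.
by apply: contra hN1 => /(memvZ t); rewrite scalerA divff // scale1r.
Qed.

Lemma scalar_comm h k : h \in 1%VS -> h * k = k * h.
Proof. by case/vlineP=> q ->; rewrite mulr_algl mulr_algr. Qed.

Lemma exists_noncommuting i a : i ^+ 2 = i + a%:A -> i \notin 1%VS ->
  exists k, k * i != i * k.
Proof.
move=> i2 iN1; have [/subvP sub|/subvPn[k _]] := boolP ({:H} <= 'C[i])%VS; last first.
  by move/cent1vP/eqP; exists k.
(* Otherwise H would be the centraliser of i, which is the plane F[i]. *)
suff : (\dim {:H} <= 2)%N by rewrite dimH.
apply: leq_trans (dim_span [:: 1; i]); apply/dimvS/subvP => k /sub/cent1vP ki.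
have [p [q ->]] := centraliser_quadratic_plane i2 iN1 quad ki.
by rewrite rpredD ?rpredZ // memv_span // !inE eqxx ?orbT.
Qed.

(** The rescaled element i = h / t satisfies i^2 = i + a.  For any k that does not
commute with i, the commutator j = k i - i k satisfies j i = (1 - i) j. *)
Lemma trace_condition_A h (t n : F) :
  h ^+ 2 = t *: h + n%:A -> t != 0 -> h \notin 1%VS -> condition_A H.
Proof.
move=> h2 t0 /(unital_quadratic h2 t0)[i [a [i2 iN1]]].
have [k kiN] := exists_noncommuting i2 iN1.
apply: (conj_comm_quaternion i2 iN1 (j := k * i - i * k)) => //.
  by rewrite subr_eq0.
have kii : k * i * i = k * i + a *: k.
  by rewrite -mulrA -expr2 i2 mulrDr mulr_algr.
have iik : i * (i * k) = i * k + a *: k.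
  by rewrite mulrA -expr2 i2 mulrDl mulr_algl.
rewrite mulrBl [RHS]mulrBl mul1r mulrBr kii iik -[i * k * i]mulrA opprB.
by rewrite -!addrA addKr.
Qed.

(** The alternative is commutativity.  If H is commutative, an element of nonzero
trace outside F would have a centraliser of dimension 2, so all squares are
scalars.  If x y != y x, some element outside F has nonzero trace: one of x, y,
x + y, or else x + 1 when 2 != 0, or else x y when 2 = 0. *)
Lemma quadratic_division_algebra : condition_A H \/ condition_B H.
Proof.
have [/subvP comm|] := boolP ({:H} <= 'C({:H}))%VS.
  have commH h k : h * k = k * h.
    by move/centvP: (comm h (memvf h)); apply; exact: memvf.
  right; split=> // h; have [t [n h2]] := quad h.
  have [/vlineP[q ->]|hN1] := boolP (h \in 1%VS).
    by rewrite exprZn expr1n memvZ // memv_line.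
  have [t0|t0] := eqVneq t 0; first by rewrite h2 t0 scale0r add0r memvZ // memv_line.
  have [i [a [i2 iN1]]] := unital_quadratic h2 t0 hN1.
  by have [k] := exists_noncommuting i2 iN1; rewrite commH eqxx.
case/subvPn=> x _ xN; left.
have {xN} [y xy] : exists y, x * y != y * x.
  have [/subvP sub|/subvPn[y _]] := boolP ({:H} <= 'C[x])%VS; last first.
    by move/cent1vP/eqP; exists y; rewrite eq_sym.
  by case/negP: xN; apply/centvP => y _; apply/esym/cent1vP/sub/memvf.
have xN1 : x \notin 1%VS by apply: contra xy => /scalar_comm->.
have yN1 : y \notin 1%VS by apply: contra xy => /(scalar_comm x)->.
have [t [n x2]] := quad x.
have [t0|t0] := eqVneq t 0; last exact: trace_condition_A x2 t0 xN1.
rewrite t0 scale0r add0r in x2.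
have [two|two] := eqVneq (2%:R : F) 0; last first.
  apply: (@trace_condition_A (x + 1) 2%:R (n - 1)) => //.
    rewrite expr2 mulrDl mul1r mulrDr mulr1 -expr2 x2 scaler_nat mulr2n.
    rewrite scalerBl scale1r -[RHS]addrA [x + 1 + (_ - _)]addrA.
    by rewrite [x + 1 + n%:A]addrAC addrK [RHS]addrC [x + n%:A]addrC.
  by apply: contra xN1 => x1; rewrite -[x](addrK 1) rpredB // memv_line.
have [s [m y2]] := quad y.
have [s0|s0] := eqVneq s 0; last exact: trace_condition_A y2 s0 yN1.
rewrite s0 scale0r add0r in y2.
have [r [l xy2]] := quad (x + y).
have xyN1 : x + y \notin 1%VS.
  apply: contra xy => /(scalar_comm x); rewrite mulrDl mulrDr.
  by move/addrI => ->.
have [r0|r0] := eqVneq r 0; last exact: trace_condition_A xy2 r0 xyN1.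
rewrite r0 scale0r add0r in xy2.
(* Here x, y and x + y have scalar squares and 2 = 0, so x y - y x is a scalar,
   and it is the trace of x y. *)
have yx : y * x = x * y + (l - n - m)%:A.
  rewrite !scalerBl -xy2 -x2 -y2 !expr2 mulrDl !mulrDr.
  rewrite -[x * x + _ + _]addrA [x * x + _]addrC (addrK (x * x)).
  rewrite [x * y + (y * x + y * y)]addrA.
  rewrite (addrK (y * y)) addrA.
  by rewrite -mulr2n -scaler_nat two scale0r add0r.
set f := l - n - m in yx.
have f0 : f != 0 by apply: contra xy => /eqP f0; rewrite yx f0 scale0r addr0.
apply: (@trace_condition_A (x * y) f (n * m)) => //.
  have -> : (x * y) ^+ 2 = x * (y * x) * y by rewrite expr2 !mulrA.
  rewrite yx mulrDr mulrDl mulr_algr -scalerAl addrC !mulrA -expr2 -mulrA.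
  by rewrite -expr2 x2 y2 mulr_algl scalerA.
apply: contra xy => xy1; have x0 : x != 0.
  by apply: contra xN1 => /eqP->; exact: mem0v.
apply/eqP; apply: (mulrI (skewH x0)); rewrite [RHS]mulrA.
exact/esym/scalar_comm.
Qed.
End QuadraticDivisionAlgebra.

(** * Bivectors of a 4-dimensional space in coordinates *)

Section KleinCoordinates.
Variable F : fieldType.
Implicit Types (u v x y z : 'rV[F]_4) (w : 'rV[F]_6).

Definition row4 (a b c d : F) : 'rV[F]_4 := \row_(i < 4) nth 0 [:: a; b; c; d] i.
Definition row6 (a b c d e f : F) : 'rV[F]_6 :=
  \row_(i < 6) nth 0 [:: a; b; c; d; e; f] i.

(** Destructing a row into named entries exposes matrix identities to [ring]. *)
Variant row4_spec : 'rV[F]_4 -> Prop := Row4 a b c d : row4_spec (row4 a b c d).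
Variant row6_spec : 'rV[F]_6 -> Prop :=
  Row6 a b c d e f : row6_spec (row6 a b c d e f).

Lemma row4P u : row4_spec u.
Proof.
pose g k := u 0 (inord k); have -> : u = row4 (g 0%N) (g 1%N) (g 2%N) (g 3%N).
  apply/rowP => i; rewrite mxE /g -[i in LHS]inord_val.
  by case: i => [[|[|[|[|]]]]].
by constructor.
Qed.

Lemma row6P w : row6_spec w.
Proof.
pose g k := w 0 (inord k).
have -> : w = row6 (g 0%N) (g 1%N) (g 2%N) (g 3%N) (g 4%N) (g 5%N).
  apply/rowP => i; rewrite mxE /g -[i in LHS]inord_val.
  by case: i => [[|[|[|[|[|[|]]]]]]].
by constructor.
Qed.

Definition skew4 (a b c d e f : F) : 'M[F]_4 := \matrix_(i < 4, j < 4)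
  nth 0 (nth [::] [:: [:: 0; a; b; c]; [:: - a; 0; d; e];
                      [:: - b; - d; 0; f]; [:: - c; - e; - f; 0]] i) j.

(** The alternating form u, v |-> w /\ u /\ v as a matrix; the coordinates of w are
ordered 01, 02, 03, 12, 13, 23. *)
Definition kform w : 'M[F]_4 :=
  skew4 (w 0 (ord6 5)) (- w 0 (ord6 4)) (w 0 (ord6 3))
        (w 0 (ord6 2)) (- w 0 (ord6 1)) (w 0 (ord6 0)).

(** The bivector w itself, as an alternating form on the dual space.  The sign makes
the products with [kform w] equal to Q(w) rather than its opposite. *)
Definition kdual w : 'M[F]_4 :=
  skew4 (- w 0 (ord6 0)) (- w 0 (ord6 1)) (- w 0 (ord6 2))
        (- w 0 (ord6 3)) (- w 0 (ord6 4)) (- w 0 (ord6 5)).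

(** The Klein quadratic form: w /\ w is twice [kquad w], so in characteristic 2 this
form carries more information than its polar form [kbil]. *)
Definition kquad w : F :=
  w 0 (ord6 0) * w 0 (ord6 5) - w 0 (ord6 1) * w 0 (ord6 4)
  + w 0 (ord6 2) * w 0 (ord6 3).

Definition kbil w w' : F :=
  w 0 (ord6 0) * w' 0 (ord6 5) + w 0 (ord6 5) * w' 0 (ord6 0)
  - w 0 (ord6 1) * w' 0 (ord6 4) - w 0 (ord6 4) * w' 0 (ord6 1)
  + w 0 (ord6 2) * w' 0 (ord6 3) + w 0 (ord6 3) * w' 0 (ord6 2).

Definition wedge u v : 'rV[F]_6 :=
  let m i j := u 0 i * v 0 j - u 0 j * v 0 i in
  row6 (m (ord4 0) (ord4 1)) (m (ord4 0) (ord4 2)) (m (ord4 0) (ord4 3))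
       (m (ord4 1) (ord4 2)) (m (ord4 1) (ord4 3)) (m (ord4 2) (ord4 3)).

Ltac mx_entries := let i := fresh in let j := fresh in
  let hi := fresh in let hj := fresh in apply/matrixP => i j;
  case: i => [[|[|[|[|[|[|i]]]]]] hi] //; case: j => [[|[|[|[|[|[|j]]]]]] hj] //.

Lemma kform6 a b c d e f :
  kform (row6 a b c d e f) = skew4 f (- e) d c (- b) a.
Proof. by rewrite /kform !mxE. Qed.

Lemma kdual6 a b c d e f :
  kdual (row6 a b c d e f) = skew4 (- a) (- b) (- c) (- d) (- e) (- f).
Proof. by rewrite /kdual !mxE. Qed.

Ltac mx_ring :=
  rewrite ?kform6 ?kdual6 ?mxE ?big_ord_recl ?big_ord0 ?mxE /= /kquad /kbil ?mxE /=;
  ring.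

Lemma kform_dual w : kform w *m kdual w = (kquad w)%:M.
Proof. by case: (row6P w) => a b c d e f; mx_entries; mx_ring. Qed.

Lemma kdual_form w : kdual w *m kform w = (kquad w)%:M.
Proof. by case: (row6P w) => a b c d e f; mx_entries; mx_ring. Qed.

Lemma kform_is_linear : linear kform.
Proof.
move=> k w w'; case: (row6P w) => a b c d e f; case: (row6P w') => a' b' c' d' e' f'.
by mx_entries; mx_ring.
Qed.
HB.instance Definition _ := GRing.isLinear.Build F _ _ _ kform kform_is_linear.

Lemma kdual_is_linear : linear kdual.
Proof.
move=> k w w'; case: (row6P w) => a b c d e f; case: (row6P w') => a' b' c' d' e' f'.
by mx_entries; mx_ring.
Qed.
HB.instance Definition _ := GRing.isLinear.Build F _ _ _ kdual kdual_is_linear.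

Lemma tr_kform w : (kform w)^T = - kform w.
Proof. by case: (row6P w) => a b c d e f; mx_entries; mx_ring. Qed.

Lemma tr_kdual w : (kdual w)^T = - kdual w.
Proof. by case: (row6P w) => a b c d e f; mx_entries; mx_ring. Qed.

Lemma kquadD w w' : kquad (w + w') = kquad w + kquad w' + kbil w w'.
Proof. by rewrite /kquad /kbil !mxE; ring. Qed.

Lemma kbilC w w' : kbil w w' = kbil w' w.
Proof. by rewrite /kbil; ring. Qed.

Lemma kbilDr w w1 w2 : kbil w (w1 + w2) = kbil w w1 + kbil w w2.
Proof. by rewrite /kbil !mxE; ring. Qed.

Lemma kbilZr a w w' : kbil w (a *: w') = a * kbil w w'.
Proof. by rewrite /kbil !mxE; ring. Qed.

Let polarize (A B C D : 'M[F]_4) w w' : A = (kquad w)%:M -> D = (kquad w')%:M ->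
  A + C + (B + D) = (kquad (w + w'))%:M -> B + C = (kbil w w')%:M.
Proof.
have scD a b : (a + b)%:M = a%:M + b%:M :> 'M[F]_4 by rewrite raddfD.
move=> -> ->; rewrite kquadD (scD (kquad w + _)) (scD (kquad w)) => e.
apply: (addrI ((kquad w)%:M + (kquad w')%:M)); rewrite -e.
by rewrite [B + C]addrC addrACA [_ + B]addrC.
Qed.

Lemma kform_dualD w w' :
  kform w *m kdual w' + kform w' *m kdual w = (kbil w w')%:M.
Proof.
apply: polarize (kform_dual w) (kform_dual w') _; rewrite -kform_dual.
by rewrite !linearD /= !mulmxDl.
Qed.

Lemma kdual_formD w w' :
  kdual w *m kform w' + kdual w' *m kform w = (kbil w w')%:M.
Proof.
apply: polarize (kdual_form w) (kdual_form w') _; rewrite -kdual_form.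
by rewrite !linearD /= !mulmxDl.
Qed.

Lemma kbil_wedge w u v : kbil w (wedge u v) = (u *m kform w *m v^T) 0 0.
Proof.
case: (row6P w) => a b c d e f; case: (row4P u) => x0 x1 x2 x3.
case: (row4P v) => y0 y1 y2 y3.
by rewrite kform6 /kbil !(mxE, big_ord_recl, big_ord0) /=; ring.
Qed.

Lemma kquad_wedge u v : kquad (wedge u v) = 0.
Proof. by rewrite /kquad !mxE /=; ring. Qed.

Lemma wedgexx u : wedge u u = 0.
Proof. by case: (row4P u) => x0 x1 x2 x3; mx_entries; mx_ring. Qed.

Lemma wedgeC u v : wedge v u = - wedge u v.
Proof.
by case: (row4P u) => x0 x1 x2 x3; case: (row4P v) => *; mx_entries; mx_ring.
Qed.

Lemma wedgeDr u v v' : wedge u (v + v') = wedge u v + wedge u v'.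
Proof.
by case: (row4P u) => *; case: (row4P v) => *; case: (row4P v') => *; mx_entries; mx_ring.
Qed.

Lemma wedgeZr a u v : wedge u (a *: v) = a *: wedge u v.
Proof. by case: (row4P u) => *; case: (row4P v) => *; mx_entries; mx_ring. Qed.

Lemma wedge0r u : wedge u 0 = 0.
Proof. by rewrite -(scale0r (0 : 'rV_4)) wedgeZr scale0r. Qed.

Lemma wedge_neq0l u v : wedge u v != 0 -> u != 0.
Proof. by apply: contra => /eqP->; rewrite wedgeC wedge0r oppr0. Qed.

(** The rows of [kdual w] span the line of a singular bivector w; the wedge of rows
i and j is the ij-coordinate of w times w. *)
Lemma klein_decomposable w k : kquad w = 0 -> exists u v, wedge u v = w 0 k *: w.
Proof.
case: (row6P w) => a b c d e f; rewrite /kquad !mxE /= => /eqP.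
rewrite addrC addr_eq0 => /eqP q0.
pose r0 := row4 0 a b c; pose r1 := row4 (- a) 0 d e.
pose r2 := row4 (- b) (- d) 0 f; pose r3 := row4 (- c) (- e) (- f) 0.
case: k => [[|[|[|[|[|[|k]]]]]] hk]; try discriminate hk;
  [exists r0, r1 | exists r0, r2 | exists r0, r3 | exists r1, r2
  | exists r1, r3 | exists r2, r3]; mx_entries; rewrite ?mxE /= ?mxE /=; ring: q0.
Qed.

Lemma wedge_eq0_cross u v i j : wedge u v = 0 -> u 0 i * v 0 j = u 0 j * v 0 i.
Proof.
case: (row4P u) => x0 x1 x2 x3; case: (row4P v) => y0 y1 y2 y3 /rowP uv0.
have := (uv0 (ord6 0), uv0 (ord6 1), uv0 (ord6 2), (uv0 (ord6 3), uv0 (ord6 4), uv0 (ord6 5))).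
rewrite !mxE /= => -[[[/subr0_eq h0 /subr0_eq h1] /subr0_eq h2]].
move=> [[/subr0_eq h3 /subr0_eq h4] /subr0_eq h5].
case: i => [[|[|[|[|i]]]] hi]; try discriminate hi;
case: j => [[|[|[|[|j]]]] hj]; try discriminate hj; rewrite ?mxE /=;
by rewrite ?(h0, h1, h2, h3, h4, h5).
Qed.

Lemma wedge_eq0 u v : wedge u v = 0 -> u != 0 -> exists a, v = a *: u.
Proof.
move=> uv0 /rV0Pn[i ui0]; exists (v 0 i / u 0 i); apply/rowP => j.
by rewrite mxE mulrAC [v 0 i * _]mulrC -(wedge_eq0_cross i j uv0) [RHS]mulrC mulKf.
Qed.
End KleinCoordinates.

(** * The even Clifford algebra of an anisotropic plane *)

Section PlaneOperators.
Variable F : fieldType.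
Implicit Types (u v : 'rV[F]_4) (w x y z : 'rV[F]_6) (c d : 'M[F]_(3, 6)).
Implicit Types (t s : 'rV[F]_4).

Lemma kformD x y : kform (x + y) = kform x + kform y.
Proof. exact: linearD. Qed.
Lemma kformZ (a : F) x : kform (a *: x) = a *: kform x.
Proof. exact: linearZ. Qed.
Lemma kdualD x y : kdual (x + y) = kdual x + kdual y.
Proof. exact: linearD. Qed.
Lemma kdualZ (a : F) x : kdual (a *: x) = a *: kdual x.
Proof. exact: linearZ. Qed.

(** A plane of bivectors is given by a matrix whose rows span it; anisotropy includes
the independence of the rows. *)
Definition anisotropic c := forall t : 'rV_3, kquad (t *m c) = 0 -> t = 0.

Definition comb c (a b g : F) :=
  a *: row (ord3 0) c + b *: row (ord3 1) c + g *: row (ord3 2) c.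

Lemma combE c a b g : comb c a b g = (\row_(k < 3) nth 0 [:: a; b; g] k) *m c.
Proof.
rewrite mulmx_sum_row !big_ord_recl big_ord0 addr0 addrA !mxE /=.
by rewrite /comb; congr (_ + _ + _); congr (_ *: row _ _); exact: val_inj.
Qed.

Lemma comb_sub c a b g : (comb c a b g <= c)%MS.
Proof. by rewrite combE submxMl. Qed.

Lemma comb_aniso c a b g : anisotropic c -> kquad (comb c a b g) = 0 ->
  [/\ a = 0, b = 0 & g = 0].
Proof.
rewrite combE => an /an/rowP t0.
by have := (t0 (ord3 0), t0 (ord3 1), t0 (ord3 2)); rewrite !mxE /= => -[[]].
Qed.

Lemma anisotropic_sub c w : anisotropic c -> (w <= c)%MS -> kquad w = 0 -> w = 0.
Proof. by move=> an /submxP[t ->] /an->; rewrite mul0mx. Qed.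

Lemma kform_kdual_swap w w' :
  kform w *m kdual w' = (kbil w w')%:M - kform w' *m kdual w.
Proof. by rewrite -kform_dualD addrK. Qed.

(** The element t0 + t1 c0 c1 + t2 c0 c2 + t3 c1 c2 of the even Clifford algebra of
the plane with rows c0, c1, c2, acting on row vectors from the right. *)
Definition even_op c t : 'M[F]_4 :=
  (t 0 (ord4 0))%:M
  + t 0 (ord4 1) *: (kform (row (ord3 0) c) *m kdual (row (ord3 1) c))
  + t 0 (ord4 2) *: (kform (row (ord3 0) c) *m kdual (row (ord3 2) c))
  + t 0 (ord4 3) *: (kform (row (ord3 1) c) *m kdual (row (ord3 2) c)).

Lemma even_op_is_linear c : linear (even_op c).
Proof.
have scD a b : (a + b)%:M = a%:M + b%:M :> 'M[F]_4 by rewrite raddfD.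
move=> a t s; rewrite /even_op !mxE scD !scalerDl !scalerDr -!scalerA scale_scalar_mx.
by rewrite [RHS]addrACA [X in _ = X + _]addrACA [X in _ = X + _ + _]addrACA.
Qed.
HB.instance Definition _ c := GRing.isLinear.Build F _ _ _ (even_op c) (even_op_is_linear c).

(** In three dimensions a bivector of the Clifford algebra is decomposable, hence an
even element is a product x z of two vectors.  If t3 != 0, take x = t2 c0 + t3 c1;
adding to z a multiple of x, for which x x = Q(x), adjusts the scalar part. *)
Lemma even_op_factor c t : anisotropic c -> t != 0 -> exists x z,
  [/\ (x <= c)%MS, (z <= c)%MS, kquad x != 0, kquad z != 0 &
      even_op c t = kform x *m kdual z].
Proof.
move=> an tn0; set a := t 0 (ord4 0); set b := t 0 (ord4 1).
set g := t 0 (ord4 2); set d := t 0 (ord4 3).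
have comb_lin a' b' g' X : kform X *m kdual (comb c a' b' g') =
    a' *: (kform X *m kdual (row (ord3 0) c)) + b' *: (kform X *m kdual (row (ord3 1) c))
    + g' *: (kform X *m kdual (row (ord3 2) c)).
  by rewrite /comb !kdualD !kdualZ !mulmxDr -!scalemxAr.
have row0 : row (ord3 0) c = comb c 1 0 0 by rewrite /comb scale1r !scale0r !addr0.
have qn a' b' g' : [|| a' != 0, b' != 0 | g' != 0] -> kquad (comb c a' b' g') != 0.
  by apply: contraTneq => /(comb_aniso an)[-> -> ->]; rewrite eqxx.
have q00 : kquad (row (ord3 0) c) != 0 by rewrite row0 qn // oner_eq0.
have [d0|dn0] := eqVneq d 0.
  exists (row (ord3 0) c), (comb c (a / kquad (row (ord3 0) c)) b g); split=> //.
  - exact: row_sub.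
  - exact: comb_sub.
  - apply: qn; apply: contraNT tn0; rewrite !negb_or !negbK.
    case/and3P=> /eqP a0 /eqP b0 /eqP g0; apply/eqP/rowP.
    move/eqP: a0; rewrite mulf_eq0 invr_eq0 (negPf q00) orbF => /eqP a0.
    by case=> [[|[|[|[|i]]]] hi]; try discriminate hi; rewrite mxE;
       [rewrite -[RHS]a0 | rewrite -[RHS]b0 | rewrite -[RHS]g0 | rewrite -[RHS]d0];
       congr (t _ _); exact: val_inj.
  rewrite comb_lin /even_op -/a -/b -/g -/d d0 scale0r addr0 kform_dual.
  by rewrite scale_scalar_mx mulfVK.
set x := comb c g d 0; set y := comb c (- (b / d)) 0 1.
have qx : kquad x != 0 by rewrite qn // dn0 orbT.
set B01 := kbil (row (ord3 0) c) (row (ord3 1) c); set Q0 := kquad (row (ord3 0) c).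
set e := (a + g * (b / d) * Q0 + b * B01) / kquad x.
exists x, (comb c (e * g - b / d) (e * d) 1); split.
- exact: comb_sub.
- exact: comb_sub.
- by [].
- by rewrite qn // oner_eq0 !orbT.
have -> : comb c (e * g - b / d) (e * d) 1 = y + e *: x.
  by apply/rowP => j; rewrite /x /y /comb !mxE; ring.
rewrite kdualD kdualZ mulmxDr -scalemxAr kform_dual.
rewrite /y comb_lin scale0r addr0 scale1r.
have xK (z : 'rV_6) : kform x *m kdual z =
    g *: (kform (row (ord3 0) c) *m kdual z) + d *: (kform (row (ord3 1) c) *m kdual z).
  by rewrite /x /comb scale0r addr0 kformD !kformZ mulmxDl -!scalemxAl.
rewrite !xK kform_dual [kform (row (ord3 1) c) *m kdual (row (ord3 0) c)]kform_kdual_swap.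
rewrite [kbil _ _]kbilC -/B01 -/Q0 /even_op -/a -/b -/g -/d.
move: (_ *m _) (_ *m _) (_ *m _) => M01 M02 M12.
rewrite [e *: _]scale_scalar_mx [e * _]mulfVK //.
apply/matrixP => i j; rewrite !mxE.
by case: (i == j); rewrite ?mulr1n ?mulr0n; field.
Qed.

Lemma even_op_unit c t : anisotropic c -> t != 0 -> even_op c t \in unitmx.
Proof.
move=> an /(even_op_factor an)[x [z [_ _ qx qz ->]]].
have unitP (A B : 'M[F]_4) q : q != 0 -> A *m B = q%:M -> A \in unitmx.
  move=> q_n0 AB; have /mulmx1_unit[] // : A *m (q^-1 *: B) = 1%:M.
  by rewrite -scalemxAr AB scale_scalar_mx mulVf.
by rewrite unitmx_mul (unitP _ _ _ qx (kform_dual x)) (unitP _ _ _ qz (kdual_form z)).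
Qed.

Definition orbit_mx c v : 'M[F]_4 := lin1_mx (fun t : 'rV_4 => v *m even_op c t).

Lemma orbit_mxE c v t : t *m orbit_mx c v = v *m even_op c t.
Proof. exact: (mul_rV_lin1 (mulmx v \o even_op c)). Qed.

(** The map t |-> v (even_op c t) is injective because nonzero even operators are
invertible, and both sides have dimension 4: v can be moved to any vector, in a
unique way. *)
Lemma orbit_unit c v : anisotropic c -> v != 0 -> orbit_mx c v \in unitmx.
Proof.
move=> an v0; rewrite -row_free_unit -kermx_eq0; apply/rowV0P => t /sub_kermxP.
rewrite orbit_mxE => vt; apply/eqP; apply: contraNT v0 => t0; apply/eqP.
by rewrite -[v](mulmxK (even_op_unit an t0)) vt mul0mx.
Qed.

(** The even operator of the plane c that maps v to u. *)
Definition even_op_to c v u := even_op c (u *m invmx (orbit_mx c v)).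

Lemma even_op_to_is_linear c v : linear (even_op_to c v).
Proof. by move=> a u u'; rewrite /even_op_to mulmxDl -scalemxAl linearP. Qed.
HB.instance Definition _ c v :=
  GRing.isLinear.Build F _ _ _ (even_op_to c v) (even_op_to_is_linear c v).

Lemma mul_even_op_to c v u : anisotropic c -> v != 0 -> v *m even_op_to c v u = u.
Proof. by move=> an v0; rewrite -orbit_mxE mulmxKV ?orbit_unit. Qed.

Lemma even_op_to_mul c v t : anisotropic c -> v != 0 ->
  even_op_to c v (v *m even_op c t) = even_op c t.
Proof. by move=> an v0; rewrite /even_op_to -orbit_mxE mulmxK ?orbit_unit. Qed.

Lemma even_op1 c : even_op c (delta_mx 0 (ord4 0)) = 1%:M.
Proof. by rewrite /even_op !mxE /= !scale0r !addr0. Qed.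

Lemma even_op_to_id c v : anisotropic c -> v != 0 -> even_op_to c v v = 1%:M.
Proof. by move=> an v0; rewrite -{2}[v]mulmx1 -(even_op1 c) even_op_to_mul. Qed.

Lemma even_op_to_coef_neq0 c v u : anisotropic c -> v != 0 -> u != 0 ->
  u *m invmx (orbit_mx c v) != 0.
Proof.
move=> an v0; apply: contra => /eqP t0; apply/eqP.
by rewrite -(mul_even_op_to u an v0) /even_op_to t0 linear0 mulmx0.
Qed.

Lemma even_op_to_unit c v u : anisotropic c -> v != 0 -> u != 0 ->
  even_op_to c v u \in unitmx.
Proof.
by move=> an v0 u0; apply: even_op_unit (even_op_to_coef_neq0 _ _ _).
Qed.

(** In the Clifford algebra, (x z)^2 = B(x, z) x z - Q(x) Q(z). *)
Lemma even_op_quadratic c t : anisotropic c ->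
  exists a b, even_op c t *m even_op c t = a *: even_op c t + b%:M.
Proof.
move=> an; have [->|/(even_op_factor an)[x [z [_ _ _ _ ->]]]] := eqVneq t 0.
  by exists 0, 0; rewrite linear0 mul0mx scaler0 raddf0 addr0.
exists (kbil x z), (- (kquad x * kquad z)).
have zx : kdual z *m kform x = (kbil x z)%:M - kdual x *m kform z.
  by rewrite kbilC -kdual_formD addrK.
rewrite !mulmxA -[kform x *m _ *m _]mulmxA zx mulmxBr mulmxBl mul_mx_scalar.
by rewrite -scalemxAl mulmxA kform_dual -mulmxA kform_dual -scalar_mxM raddfN.
Qed.

Definition orthogonal_planes c d :=
  forall x y : 'rV_6, (x <= c)%MS -> (y <= d)%MS -> kbil x y = 0.

Lemma kform_kdual_anti x y : kbil x y = 0 -> kform x *m kdual y = - (kform y *m kdual x).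
Proof. by move=> xy; rewrite kform_kdual_swap xy raddf0 sub0r. Qed.

Lemma kdual_kform_anti x y : kbil x y = 0 -> kdual x *m kform y = - (kdual y *m kform x).
Proof. by move=> xy; apply/eqP; rewrite -addr_eq0 kdual_formD xy raddf0. Qed.

(** Vectors of orthogonal planes anticommute, so products of two of them commute. *)
Lemma even_op_comm c d t s : anisotropic c -> anisotropic d -> orthogonal_planes c d ->
  even_op c t *m even_op d s = even_op d s *m even_op c t.
Proof.
move=> aniso_c aniso_d cd; have [->|] := eqVneq t 0; first by rewrite linear0 mul0mx mulmx0.
case/(even_op_factor aniso_c) => x [z [xc zc _ _ ->]].
have [->|] := eqVneq s 0; first by rewrite linear0 mul0mx mulmx0.
case/(even_op_factor aniso_d) => x' [z' [xd zd _ _ ->]].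
rewrite !mulmxA -[kform x *m _ *m _]mulmxA (kdual_kform_anti (cd _ _ zc xd)).
rewrite mulmxN mulNmx -!mulmxA (kform_kdual_anti (cd _ _ zc zd)) !mulmxN opprK.
rewrite !mulmxA (kform_kdual_anti (cd _ _ xc xd)) !mulNmx.
rewrite -[_ *m kdual x *m _]mulmxA (kdual_kform_anti (cd _ _ xc zd)).
by rewrite mulmxN mulNmx opprK !mulmxA.
Qed.

(** Write the operator as x z.  Moving y past z and then past x costs two signs and
leaves the scalars z z = Q(z) and x x = Q(x), whatever y is. *)
Lemma even_op_similitude c d t : anisotropic c -> orthogonal_planes c d -> t != 0 ->
  exists2 q, q != 0 & forall y, (y <= d)%MS ->
    even_op c t *m kform y *m (even_op c t)^T = q *: kform y.
Proof.
move=> an cd /(even_op_factor an)[x [z [xc zc qx qz ->]]].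
exists (kquad x * kquad z); first by rewrite mulf_neq0.
move=> y yd.
rewrite trmx_mul tr_kform tr_kdual mulNmx !mulmxN opprK.
have -> : kform x *m kdual z *m kform y *m (kdual z *m kform x) =
    kform x *m (kdual z *m kform y) *m kdual z *m kform x by rewrite !mulmxA.
rewrite (kdual_kform_anti (cd _ _ zc yd)) mulmxN !mulNmx.
have -> : kform x *m (kdual y *m kform z) *m kdual z *m kform x =
    (kform x *m kdual y) *m (kform z *m kdual z) *m kform x by rewrite !mulmxA.
rewrite (kform_kdual_anti (cd _ _ xc yd)) kform_dual mul_mx_scalar scalerN.
by rewrite mulNmx opprK -scalemxAl -mulmxA kdual_form mul_mx_scalar scalerA mulrC.
Qed.

Lemma kbil0r w : kbil w 0 = 0.
Proof. by rewrite -(scale0r w) kbilZr mul0r. Qed.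

Lemma kform_wedge w u v : u *m kform w *m v^T = (kbil w (wedge u v))%:M.
Proof. by rewrite [LHS]mx11_scalar -kbil_wedge. Qed.

Lemma kbil_wedge_op c d t : anisotropic c -> orthogonal_planes c d -> t != 0 ->
  exists2 q, q != 0 & forall y u v, (y <= d)%MS ->
    kbil y (wedge (u *m even_op c t) (v *m even_op c t)) = q * kbil y (wedge u v).
Proof.
move=> an cd /(even_op_similitude an cd)[q q0 e]; exists q => // y u v yd.
by rewrite !kbil_wedge trmx_mul !mulmxA -(mulmxA u) -(mulmxA u) e // -scalemxAr -scalemxAl mxE.
Qed.

(** The Hodge dual, which turns the polar form into the standard scalar product. *)
Definition kdualize w : 'rV[F]_6 :=
  row6 (w 0 (ord6 5)) (- w 0 (ord6 4)) (w 0 (ord6 3))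
       (w 0 (ord6 2)) (- w 0 (ord6 1)) (w 0 (ord6 0)).

Lemma kdualize_is_linear : linear kdualize.
Proof.
move=> a x y; apply/rowP => -[[|[|[|[|[|[|i]]]]]] hi]; try discriminate hi;
  by rewrite /kdualize !mxE /=; ring.
Qed.
HB.instance Definition _ :=
  GRing.isLinear.Build F _ _ _ kdualize kdualize_is_linear.

Lemma kdualizeK : involutive kdualize.
Proof.
by move=> w; case: (row6P w) => *; rewrite /kdualize !mxE /= !opprK.
Qed.

Lemma kdualizeE x y : kdualize x *m y^T = (kbil x y)%:M.
Proof.
rewrite [LHS]mx11_scalar; congr (_%:M); rewrite mxE /kbil.
case: (row6P x) => a b c d e f; case: (row6P y) => a' b' c' d' e' f'.
by rewrite !big_ord_recl big_ord0 /kdualize !mxE /=; ring.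
Qed.

Definition gram : 'M[F]_6 := lin1_mx kdualize.

Lemma gramE x y : x *m gram *m y^T = (kbil x y)%:M.
Proof. by rewrite mul_rV_lin1 kdualizeE. Qed.

Lemma gram_unit : gram \in unitmx.
Proof.
have /mulmx1_unit[] // : gram *m gram = 1%:M.
by apply/row_matrixP => i; rewrite !rowE mulmxA !mul_rV_lin1 /= kdualizeK mulmx1.
Qed.

Definition perp_planes c d := forall w, (w <= d)%MS = (w *m gram *m c^T == 0).

Lemma perp_exists c : row_free c -> exists2 d : 'M_(3, 6), row_free d & perp_planes c d.
Proof.
move=> fc; set K := kermx (gram *m c^T).
have rK : \rank K = 3.
  by rewrite mxrank_ker eqmxMfull ?row_full_unit ?gram_unit // mxrank_tr (eqP fc).
exists (castmx (rK, erefl) (row_base K)).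
  by rewrite /row_free eqmx_cast eq_row_base rK.
by move=> w; rewrite eqmx_cast eq_row_base; apply/sub_kermxP/eqP; rewrite mulmxA.
Qed.

Lemma perp_orthogonal c d : perp_planes c d -> orthogonal_planes c d.
Proof.
move=> cd x y /submxP[t ->]; rewrite cd => /eqP y0.
have /matrixP/(_ 0 0) := gramE y (t *m c).
by rewrite trmx_mul mulmxA y0 mul0mx !mxE eqxx mulr1n kbilC.
Qed.

Lemma gram_coef k l : gram k l = kbil (delta_mx 0 k) (delta_mx 0 l).
Proof.
have /matrixP/(_ 0 0) := gramE (delta_mx 0 k) (delta_mx 0 l).
by rewrite trmx_delta -rowE -colE !mxE eqxx mulr1n.
Qed.

Lemma tr_gram : gram^T = gram.
Proof. by apply/matrixP => i j; rewrite mxE !gram_coef kbilC. Qed.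

Lemma perp_planesP c d w : perp_planes c d ->
  reflect (forall x, (x <= c)%MS -> kbil x w = 0) (w <= d)%MS.
Proof.
move=> cd; apply: (iffP idP) => [wd x xc|w0]; first exact: perp_orthogonal cd _ _ xc wd.
rewrite cd; apply/eqP/trmx_inj/row_matrixP => i.
rewrite !trmx_mul trmxK tr_gram trmx0 row0 mulmxA !row_mul gramE.
by rewrite w0 ?row_sub ?raddf0.
Qed.

(** Both planes have dimension 3 = 6 - 3, so the inclusion of c in the polar of d is
an equality. *)
Lemma perp_planes_sym c d : row_free c -> row_free d -> perp_planes c d -> perp_planes d c.
Proof.
move=> fc fd cd w.
have dc : d *m gram *m c^T = 0.
  by apply/row_matrixP => i; rewrite !row_mul row0; apply/eqP; rewrite -cd row_sub.
have sub : (c <= kermx (gram *m d^T))%MS.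
  by apply/sub_kermxP/trmx_inj; rewrite !trmx_mul trmxK tr_gram dc trmx0.
have : (c == kermx (gram *m d^T))%MS.
  rewrite -(mxrank_leqif_eq sub) mxrank_ker eqmxMfull ?row_full_unit ?gram_unit //.
  by rewrite mxrank_tr (eqP fc) (eqP fd).
by move/eqmxP=> cK; rewrite cK -mulmxA; apply/sub_kermxP/eqP.
Qed.

(** A singular element of d is some u /\ v.  The three independent covectors obtained
from u and a basis of c then all vanish on u and on v, but the annihilator of the
span of u and v is only 2-dimensional. *)
Lemma perp_anisotropic c d : row_free d -> anisotropic c -> orthogonal_planes c d ->
  anisotropic d.
Proof.
move=> fd an cd s qs; set w := s *m d in qs.
have wd : (w <= d)%MS by exact: submxMl.
apply/eqP; apply/negP => /negP s0.
have /rV0Pn[k wk] : w != 0 by rewrite mulmx_free_eq0.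
have [u [v uv]] := klein_decomposable k qs.
have uvd : (wedge u v <= d)%MS by rewrite uv scalemx_sub.
have uv0 : wedge u v != 0.
  by rewrite uv scaler_eq0 negb_or wk; apply/rV0Pn; exists k.
have u0 := wedge_neq0l uv0.
pose A := c *m lin1_mx (mulmx u \o @kform F).
have AE (t : 'rV_3) : t *m A = u *m kform (t *m c) by rewrite /A mulmxA mul_rV_lin1.
have fA : row_free A.
  rewrite -kermx_eq0; apply/rowV0P => t /sub_kermxP; rewrite AE => ut; apply: an.
  apply/eqP; apply: contraNT u0 => q0; apply/eqP.
  apply: (scalerI q0); rewrite scaler0 -mul_mx_scalar -kform_dual mulmxA ut.
  by rewrite mul0mx.
have fB : row_free (col_mx u v).
  rewrite -kermx_eq0; apply/rowV0P => t /sub_kermxP.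
  rewrite -[t]hsubmxK mul_row_col [lsubmx t]mx11_scalar [rsubmx t]mx11_scalar.
  rewrite !mul_scalar_mx; move: (lsubmx t 0 0) (rsubmx t 0 0) => a b ab0.
  have b0 : b = 0.
    apply/eqP; have /eqP : wedge u (a *: u + b *: v) = 0.
      by rewrite ab0 wedge0r.
    by rewrite wedgeDr !wedgeZr wedgexx scaler0 add0r scaler_eq0 (negPf uv0) orbF.
  move/eqP: ab0; rewrite b0 scale0r addr0 scaler_eq0 (negPf u0) orbF => /eqP->.
  by rewrite raddf0 row_mx0.
have : A *m (col_mx u v)^T = 0.
  apply/row_matrixP => i; rewrite row0 rowE mulmxA AE -rowE tr_col_mx mul_mx_row.
  by rewrite !kform_wedge wedgexx (cd _ _ (row_sub i c) uvd) kbil0r raddf0 row_mx0.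
by move/mulmx0_rank_max; rewrite mxrank_tr (eqP fA) (eqP fB).
Qed.
End PlaneOperators.

(** * The exterior algebra in coordinates *)

Section ExteriorCoordinates.
Variables (F : fieldType) (V : vectType F).
Hypothesis dimV : \dim {:V} = 4%N.
Implicit Types (u v : 'rV[F]_4) (w : 'rV[F]_6).

Definition frame : 4.-tuple V := tcast dimV (vbasis {:V}).

Lemma frameE (i : 'I_4) : frame`_i = (vbasis {:V})`_(cast_ord (esym dimV) i).
Proof. by rewrite /frame val_tcast. Qed.

Lemma frame_basis : basis_of {:V} frame.
Proof. by rewrite /frame val_tcast; exact: vbasisP. Qed.

Definition vec u : V := \sum_i u 0 i *: frame`_i.

Lemma vec_is_linear : linear vec.
Proof.
move=> a u v; rewrite linear_sum -big_split /=; apply: eq_bigr => i _.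
by rewrite !mxE scalerDl scalerA.
Qed.
HB.instance Definition _ := GRing.isLinear.Build F _ _ _ vec vec_is_linear.

Definition coords (x : V) : 'rV[F]_4 := \row_i coord frame i x.

Lemma coords_is_linear : linear coords.
Proof. by move=> a x y; apply/rowP => i; rewrite !mxE linearP. Qed.
HB.instance Definition _ := GRing.isLinear.Build F _ _ _ coords coords_is_linear.

Lemma vecK : cancel vec coords.
Proof.
by move=> u; apply/rowP => i; rewrite mxE coord_sum_free ?(basis_free frame_basis).
Qed.

Lemma coordsK : cancel coords vec.
Proof.
move=> x; rewrite [x in RHS](coord_basis frame_basis) ?memvf //.
by apply: eq_bigr => i; rewrite !mxE.
Qed.

Definition eps (i : 'I_4) : exterior V := ext_in V frame`_i.

Lemma eps_mon i : eps i = ext_mon F [set cast_ord (esym dimV) i].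
Proof.
pose j := cast_ord (esym dimV) i; rewrite /eps lfunE /= /ext_vec frameE -/j.
move: j => j; rewrite (bigD1 j) // big1 ?addr0 => [|k kj];
  rewrite coord_free ?(basis_free (vbasisP _)) //.
  by rewrite /= eqxx scale1r addr0.
by rewrite eq_sym (negPf kj) scale0r.
Qed.

Lemma eps_sqr i : eps i * eps i = 0. Proof. exact: ext_in_sqr. Qed.
Lemma epsC i j : eps i * eps j = - (eps j * eps i). Proof. exact: ext_inC. Qed.
Lemma eps_sqrA i x : eps i * (eps i * x) = 0.
Proof. by rewrite mulrA eps_sqr mul0r. Qed.
Lemma epsCA i j x : eps i * (eps j * x) = - (eps j * (eps i * x)).
Proof. by rewrite mulrA epsC mulNr mulrA. Qed.

Local Notation e0 := (eps (ord4 0)).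
Local Notation e1 := (eps (ord4 1)).
Local Notation e2 := (eps (ord4 2)).
Local Notation e3 := (eps (ord4 3)).

(** The generator of the top exterior power. *)
Definition omega := e0 * (e1 * (e2 * e3)).

Lemma omega_neq0 : omega != 0.
Proof.
rewrite /omega !eps_mon.
by do 3![rewrite ext_monU ?disjoints1 ?inE -?val_eqE // -?scalerAr];
  rewrite !scaler_eq0 !signr_eq0 (negPf (ext_mon_neq0 _ _)).
Qed.

Definition eps2 (k : 'I_6) : exterior V :=
  nth 0 [:: e0 * e1; e0 * e2; e0 * e3; e1 * e2; e1 * e3; e2 * e3] k.

Definition bivec w : exterior V := \sum_k w 0 k *: eps2 k.

Lemma bivec_is_linear : linear bivec.
Proof.
move=> a w w'; rewrite /bivec scaler_sumr -big_split /=; apply: eq_bigr => k _.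
by rewrite !mxE scalerDl scalerA.
Qed.
HB.instance Definition _ := GRing.isLinear.Build F _ _ _ bivec bivec_is_linear.

Lemma ord6_ind (P : 'I_6 -> Prop) :
  P (ord6 0) -> P (ord6 1) -> P (ord6 2) -> P (ord6 3) -> P (ord6 4) -> P (ord6 5) ->
  forall k, P k.
Proof.
move=> h0 h1 h2 h3 h4 h5 [[|[|[|[|[|[|m]]]]]] hm]; try discriminate hm;
  by rewrite (bool_irrelevance hm isT).
Qed.

Lemma eps2_mul k l : eps2 k * eps2 l = gram F k l *: omega.
Proof.
rewrite gram_coef /kbil !mxE /eps2 /omega.
have c10 x := epsCA (ord4 1) (ord4 0) x.
have c20 x := epsCA (ord4 2) (ord4 0) x.
have c30 x := epsCA (ord4 3) (ord4 0) x.
have c21 x := epsCA (ord4 2) (ord4 1) x.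
have c31 x := epsCA (ord4 3) (ord4 1) x.
have c32 x := epsCA (ord4 3) (ord4 2) x.
have t10 := epsC (ord4 1) (ord4 0).
have t20 := epsC (ord4 2) (ord4 0).
have t30 := epsC (ord4 3) (ord4 0).
have t21 := epsC (ord4 2) (ord4 1).
have t31 := epsC (ord4 3) (ord4 1).
have t32 := epsC (ord4 3) (ord4 2).
move: k l; apply: ord6_ind; apply: ord6_ind => /=;
  rewrite -!mulrA ?mulr0n ?mulr1n;
  rewrite ?(mul0r, mulr0, mul1r, subr0, addr0, add0r, scale0r, scale1r);
  rewrite ?(oppr0, scale0r, scaleN1r);
  by rewrite ?(eps_sqr, eps_sqrA, c10, c20, c30, c21, c31, c32, t10, t20, t30,
    t21, t31, t32, mulrN, mulNr, mulr0, opprK, oppr0).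
Qed.

Lemma bivec_mul w w' : bivec w * bivec w' = kbil w w' *: omega.
Proof.
have -> : kbil w w' = \sum_k \sum_l w 0 k * w' 0 l * gram F k l.
  have /matrixP/(_ 0 0) := gramE w w'; rewrite !mxE eqxx mulr1n => <-.
  rewrite exchange_big /=; apply: eq_bigr => l _; rewrite !mxE mulr_suml.
  by apply: eq_bigr => k _; rewrite mulrAC.
rewrite /bivec mulr_suml scaler_suml; apply: eq_bigr => k _.
rewrite mulr_sumr scaler_suml; apply: eq_bigr => l _.
by rewrite -scalerAl -scalerAr eps2_mul !scalerA.
Qed.

Lemma bivec_wedge u v : ext_in V (vec u) * ext_in V (vec v) = bivec (wedge u v).
Proof.
have ext_vecE x : ext_in V (vec x) = \sum_i x 0 i *: eps i.
  by rewrite /vec linear_sum; apply: eq_bigr => i _; rewrite linearZ.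
transitivity (\sum_i \sum_j (u 0 i * v 0 j) *: (eps i * eps j)).
  rewrite !ext_vecE mulr_suml; apply: eq_bigr => i _; rewrite mulr_sumr.
  by apply: eq_bigr => j _; rewrite -scalerAl -scalerAr scalerA.
case: (row4P u) => x0 x1 x2 x3; case: (row4P v) => y0 y1 y2 y3.
rewrite /bivec /eps2 !big_ord_recl !big_ord0 !mxE /= !addr0.
have l0 : ord0 = ord4 0 by exact: val_inj.
have l1 : lift ord0 ord0 = ord4 1 by exact: val_inj.
have l2 : lift ord0 (lift ord0 ord0) = ord4 2 by exact: val_inj.
have l3 : lift ord0 (lift ord0 (lift ord0 ord0)) = ord4 3.
  exact: val_inj.
rewrite l3 l2 l1 l0 !eps_sqr.
rewrite [e1 * e0]epsC [e2 * e0]epsC [e3 * e0]epsC.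
rewrite [e2 * e1]epsC [e3 * e1]epsC [e3 * e2]epsC.
move: (e0 * e1) (e0 * e2) (e0 * e3) (e1 * e2) (e1 * e3) (e2 * e3).
move=> E01 E02 E03 E12 E13 E23; apply/ffunP => S; rewrite !ffunE.
by rewrite /GRing.scale /=; ring.
Qed.

Lemma bivec_eq0 w : bivec w = 0 -> w = 0.
Proof.
move=> w0; apply: (can_inj (@kdualizeK F)); rewrite [RHS]linear0.
apply/rowP => k; rewrite mxE -[LHS]mulr1.
have : kbil w (delta_mx 0 k) = 0.
  apply/eqP; have := bivec_mul w (delta_mx 0 k); rewrite w0 mul0r => /esym/eqP.
  by rewrite scaler_eq0 (negPf omega_neq0) orbF.
have /matrixP/(_ 0 0) := kdualizeE w (delta_mx 0 k).
by rewrite trmx_delta -colE !mxE eqxx mulr1n mulr1 => -> ->.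
Qed.

Lemma bivec_inj : injective bivec.
Proof.
move=> w w' /eqP; rewrite -subr_eq0 -linearB => /eqP/bivec_eq0/eqP.
by rewrite subr_eq0 => /eqP.
Qed.

Lemma ext_pow2P X : reflect (exists w, X = bivec w) (X \in ext_pow V 2).
Proof.
apply: (iffP idP) => [|[w ->]]; last first.
  rewrite rpred_sum // => k _; rewrite memvZ // /ext_pow expv2.
  by move: k; apply: ord6_ind; rewrite /eps2 /= memv_mul ?memv_img ?memvf.
suff /subvP sub : (ext_pow V 2 <= limg (linfun bivec))%VS.
  by move/sub/memv_imgP => [w _ ->]; exists w; rewrite lfunE.
rewrite /ext_pow expv2; apply/prodvP => _ _ /memv_imgP[x _ ->] /memv_imgP[y _ ->].
by rewrite -[x]coordsK -[y]coordsK bivec_wedge -(lfunE bivec) memv_img ?memvf.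
Qed.

(** Every plane of bivectors has this form by [plane_of_surj]; the matrix gives access
to the coordinate form of the Klein quadric. *)
Definition plane_of (c : 'M[F]_(3, 6)) : {vspace exterior V} :=
  limg (linfun (bivec \o mulmxr c)).

Lemma mem_plane_of c w : (bivec w \in plane_of c) = (w <= c)%MS.
Proof.
apply/memv_imgP/submxP => [[t _]|[t ->]]; last by exists t; rewrite ?memvf // lfunE.
by rewrite lfunE => /bivec_inj ->; exists t.
Qed.

Lemma plane_ofP c X : reflect (exists2 w, (w <= c)%MS & X = bivec w) (X \in plane_of c).
Proof.
apply: (iffP idP) => [|[w wc ->]]; last by rewrite mem_plane_of.
by case/memv_imgP => t _ ->; exists (t *m c); rewrite ?submxMl // lfunE.
Qed.

Lemma dim_plane_of c : row_free c -> \dim (plane_of c) = 3.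
Proof.
move=> fc; rewrite limg_dim_eq ?dimvf ?/dim //=.
apply/eqP; rewrite -subv0 capfv; apply/subvP => t.
rewrite memv_ker lfunE /= => /eqP/bivec_eq0/eqP.
by rewrite mulmx_free_eq0 // => /eqP->; exact: mem0v.
Qed.

Lemma plane_of_surj C : (C <= ext_pow V 2)%VS -> \dim C = 3 ->
  exists2 c, row_free c & C = plane_of c.
Proof.
move=> sC dC; pose X := tcast dC (vbasis C).
have bX : basis_of C X by rewrite val_tcast; exact: vbasisP.
have Xw k : exists w, X`_k == bivec w.
  have [w ->] : exists w, X`_k = bivec w; last by exists w.
  apply/ext_pow2P/(subvP sC); have [ltk|gek] := ltnP k (size X).
    exact: (basis_mem bX (mem_nth _ ltk)).
  by rewrite nth_default ?mem0v.
pose c := \matrix_(k < 3) xchoose (Xw k).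
have cE t : bivec (t *m c) = \sum_k t 0 k *: X`_k.
  rewrite mulmx_sum_row linear_sum; apply: eq_bigr => k _.
  by rewrite linearZ rowK; congr (_ *: _); apply/esym/eqP/(xchooseP (Xw k)).
have fc : row_free c.
  rewrite -kermx_eq0; apply/rowV0P => t /sub_kermxP tc; apply/rowP => k.
  move: (congr1 bivec tc); rewrite cE linear0 mxE.
  by move/freeP: (basis_free bX) => fX /fX.
exists c => //; apply/esym/eqP; rewrite eqEdim dim_plane_of // dC leqnn andbT.
apply/subvP => _ /plane_ofP[w /submxP[t ->] ->]; rewrite cE.
by apply: rpred_sum => k _; rewrite memvZ // (basis_mem bX) // mem_nth ?size_tuple.
Qed.

Lemma polar_plane_of c d : perp_planes c d -> polar (plane_of c) = plane_of d.
Proof.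
move=> cd; apply/vspaceP => y; apply/polarP/plane_ofP => [[/ext_pow2P[w ->] cw]|[w wd ->]].
  exists w => //; apply/(perp_planesP _ cd) => x xc; apply/eqP.
  have := cw (bivec x); rewrite mem_plane_of bivec_mul => /(_ xc)/eqP.
  by rewrite scaler_eq0 (negPf omega_neq0) orbF.
split=> [|_ /plane_ofP[x xc ->]]; first by apply/ext_pow2P; exists w.
by rewrite bivec_mul (perp_planesP _ cd wd) ?scale0r.
Qed.

Definition span2 u v : {vspace V} := <<[:: vec u; vec v]>>%VS.

Lemma vec_inj : injective vec. Proof. exact: can_inj vecK. Qed.

Lemma vec_eq0 u : (vec u == 0) = (u == 0).
Proof. by rewrite -(inj_eq vec_inj) linear0. Qed.

Lemma span2_basis u v : wedge u v != 0 -> basis_of (span2 u v) [:: vec u; vec v].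
Proof.
move=> uv; rewrite /basis_of eqxx /= free_cons seq1_free span_seq1 vec_eq0.
have v0 : v != 0.
  by apply: contra uv => /eqP->; rewrite wedge0r.
rewrite v0 andbT; apply: contra uv => /vlineP[a]; rewrite -linearZ => /vec_inj ->.
by rewrite wedgeC wedgeZr wedgexx scaler0 oppr0.
Qed.

Lemma span2_line u v : wedge u v != 0 -> line (span2 u v).
Proof. by move/span2_basis => b; exact: size_basis (b : basis_of _ [tuple _; _]). Qed.

Lemma plucker_span2 u v : wedge u v != 0 -> plucker (span2 u v) = <[bivec (wedge u v)]>%VS.
Proof. by move/span2_basis/pluckerE->; rewrite bivec_wedge. Qed.

Lemma lineP M : line M -> exists u v, wedge u v != 0 /\ M = span2 u v.
Proof.
move=> dM; have : basis_of M (tcast dM (vbasis M)).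
  by rewrite val_tcast; exact: vbasisP.
case/tupleP: (tcast _ _) => x X; case/tupleP: X => y X.
rewrite tuple0 /= => bM; exists (coords x), (coords y).
rewrite /span2 !coordsK (span_basis bM); split=> //.
move/basis_free: bM; rewrite free_cons span_seq1 seq1_free => /andP[xy y0].
apply: contra xy => /eqP xy0; apply/vlineP.
have cy0 : coords y != 0 by apply: contra y0 => /eqP y0; rewrite -[y]coordsK y0 linear0.
have [||a xE] := @wedge_eq0 _ (coords y) (coords x) => //; first by rewrite wedgeC xy0 oppr0.
by exists a; rewrite -[x]coordsK xE linearZ /= coordsK.
Qed.

End ExteriorCoordinates.

(** * Parallel classes as orbits, and the double space *)

Section KleinParallelism.
Variables (F : fieldType) (V : vectType F).
Hypothesis dimV : \dim {:V} = 4%N.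
Local Notation vec := (vec dimV).
Local Notation coords := (coords dimV).
Local Notation span2 := (span2 dimV).
Local Notation bivec := (bivec dimV).
Local Notation plane_of := (plane_of dimV).
Implicit Types (u v x y : 'rV[F]_4) (w : 'rV[F]_6) (c d : 'M[F]_(3, 6)).
Implicit Types (M N : {vspace V}).

Lemma mem_span2 u v a b : vec (a *: u + b *: v) \in span2 u v.
Proof. by rewrite linearD !linearZ rpredD ?memvZ // memv_span ?inE ?eqxx ?orbT. Qed.

Lemma span2_through M x : line M -> x != 0 -> vec x \in M ->
  exists2 y, wedge x y != 0 & M = span2 x y.
Proof.
move=> lM x0 xM; have /subvPn[y yM yx] : ~~ (M <= <[vec x]>)%VS.
  by apply/negP => /dimvS; rewrite lM dim_vline; case: (_ == _).
have xy : wedge x (coords y) != 0.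
  apply: contra yx => /eqP/wedge_eq0/(_ x0)[a ya].
  by rewrite -[y](coordsK dimV) ya linearZ memvZ ?memv_line.
exists (coords y) => //; apply/esym/eqP; rewrite eqEdim (span2_line dimV xy) lM leqnn andbT.
by apply/span_subvP => z; rewrite !inE => /orP[] /eqP-> //; rewrite coordsK.
Qed.

Lemma span2_eq M x y : wedge x y != 0 -> line M -> vec x \in M -> vec y \in M ->
  M = span2 x y.
Proof.
move=> xy lM xM yM; apply/esym/eqP; rewrite eqEdim (span2_line dimV xy) lM leqnn andbT.
by apply/span_subvP => z; rewrite !inE => /orP[] /eqP->.
Qed.

Lemma pointP (p : {vspace V}) : point p -> exists2 x, x != 0 & p = <[vec x]>%VS.
Proof.
move=> dimp; have pick0 : vpick p != 0 by rewrite vpick0 -dimv_eq0 dimp.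
exists (coords (vpick p)).
  by apply: contra pick0 => /eqP p_eq0; rewrite -[vpick p](coordsK dimV) p_eq0 linear0.
by apply/esym/eqP; rewrite coordsK eqEdim -memvE memv_pick dim_vline pick0 dimp.
Qed.

Lemma point_vec x : x != 0 -> point <[vec x]>%VS.
Proof. by rewrite /point dim_vline vec_eq0 => ->. Qed.

Lemma externalP c : row_free c -> external (plane_of c) <-> anisotropic c.
Proof.
move=> fc; split=> [ext t qt|an [X [M lM ->]]].
  apply/eqP; apply/negP => /negP t0; apply: ext.
  have /rV0Pn[k wk] : t *m c != 0 by rewrite mulmx_free_eq0.
  have [u [v uv]] := klein_decomposable k qt.
  have uv0 : wedge u v != 0.
    by rewrite uv scaler_eq0 negb_or wk; apply/rV0Pn; exists k.
  exists (plucker (span2 u v)); first by exists (span2 u v) => //; exact: span2_line.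
  by rewrite plucker_span2 // -memvE mem_plane_of uv scalemx_sub ?submxMl.
case: (lineP dimV lM) => u [v [uv ->]]; rewrite plucker_span2 // -memvE mem_plane_of.
move/(anisotropic_sub an)/(_ (kquad_wedge u v)) => uv0.
by rewrite uv0 eqxx in uv.
Qed.

Section Plane.
Variables c d : 'M[F]_(3, 6).
Hypotheses (aniso_c : anisotropic c) (perp : perp_planes c d) (perp' : perp_planes d c).

Lemma wedge_sub_eq0 u v : (wedge u v <= c)%MS -> wedge u v = 0.
Proof. by move/(anisotropic_sub aniso_c)/(_ (kquad_wedge u v)). Qed.

(** The factor k is nonzero because the Klein point of a line does not lie in the
plane. *)
Lemma klein_parallelP u v x y : wedge u v != 0 -> wedge x y != 0 ->
  klein_parallel (plane_of c) (span2 u v) (span2 x y) <->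
  exists2 k, k != 0 & (wedge u v - k *: wedge x y <= c)%MS.
Proof.
move=> uv xy; rewrite /klein_parallel !plucker_span2 //; split=> [e|[k k0 kc]].
  have : bivec (wedge u v) \in (plane_of c + <[bivec (wedge x y)]>)%VS.
    by rewrite -e (subvP (addvSr _ _)) ?memv_line.
  case/memv_addP => _ /plane_ofP[w wc ->] [_ /vlineP[k ->]].
  rewrite -linearZ -linearD => /(@bivec_inj _ _ dimV) uvE; exists k.
    apply: contra uv => /eqP k0; apply/eqP/wedge_sub_eq0.
    by rewrite uvE k0 scale0r addr0.
  by rewrite uvE addrK.
set w := wedge u v - k *: wedge x y in kc.
have bw : bivec w \in plane_of c by rewrite mem_plane_of.
have uvE : wedge u v = w + k *: wedge x y by rewrite /w subrK.
have xyE : wedge x y = k^-1 *: (wedge u v - w).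
  by rewrite uvE addrC addKr scalerA mulVf ?scale1r.
apply/eqP; rewrite eqEsubv !subv_add !addvSl -!memvE /=; apply/andP; split.
  by rewrite uvE linearD linearZ memv_add // memvZ ?memv_line.
by rewrite xyE linearZ memvZ // linearB addrC memv_add ?memv_line ?memvN.
Qed.

Lemma wedge_op u v t : t != 0 -> wedge u v != 0 ->
  wedge (u *m even_op c t) (v *m even_op c t) != 0.
Proof.
move=> t0 uv; have uT := even_op_unit aniso_c t0.
have u0 : u *m even_op c t != 0.
  apply: contra (wedge_neq0l uv) => /eqP e; apply/eqP.
  by rewrite -[u](mulmxK uT) e mul0mx.
apply: contra uv => /eqP/wedge_eq0/(_ u0)[a]; rewrite scalemxAl.
by move/(can_inj (mulmxK uT)) => ->; rewrite wedgeZr wedgexx scaler0.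
Qed.

(** The difference of the new Klein vector and a multiple of the old one is
orthogonal to the polar plane d, hence lies in c. *)
Lemma klein_parallel_even_op u v t : t != 0 -> wedge u v != 0 ->
  klein_parallel (plane_of c) (span2 (u *m even_op c t) (v *m even_op c t)) (span2 u v).
Proof.
move=> t0 uv; apply/klein_parallelP => //; first exact: wedge_op.
have cd := perp_orthogonal perp; have [q q0 e] := kbil_wedge_op aniso_c cd t0.
exists q => //; apply/(perp_planesP _ perp') => y yd.
by rewrite -scaleNr kbilDr kbilZr e // mulNr subrr.
Qed.

(** If x /\ y - k x /\ z = x /\ (y - k z) lies in c, it vanishes, so y - k z is a
multiple of x. *)
Lemma klein_parallel_unique M N x : line M -> line N -> x != 0 ->
  vec x \in M -> vec x \in N -> klein_parallel (plane_of c) M N -> M = N.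
Proof.
move=> lM lN x0 xM xN; have [y xy ME] := span2_through lM x0 xM.
have [z xz NE] := span2_through lN x0 xN.
rewrite {1}ME {1}NE => /(klein_parallelP xy xz)[k k0].
have -> : wedge x y - k *: wedge x z = wedge x (y - k *: z).
  by rewrite wedgeDr -!scaleNr wedgeZr.
move/wedge_sub_eq0/wedge_eq0/(_ x0) => [a yz].
have yE : y = a *: x + k *: z by rewrite -yz subrK.
by rewrite ME; apply/esym/span2_eq => //; rewrite NE yE mem_span2.
Qed.

Lemma klein_parallel_exists M x : line M -> x != 0 ->
  exists u v t, [/\ t != 0, wedge u v != 0, M = span2 u v & x = u *m even_op c t].
Proof.
move=> lM x0; have [u [v [uv ME]]] := lineP dimV lM.
have u0 := wedge_neq0l uv; have xE := mul_even_op_to x aniso_c u0.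
by exists u, v, (x *m invmx (orbit_mx c u)); rewrite even_op_to_coef_neq0.
Qed.

Lemma klein_parallel_line u v t : t != 0 -> wedge u v != 0 ->
  unique (fun N => [/\ line N, (<[vec (u *m even_op c t)]> <= N)%VS
                     & klein_parallel (plane_of c) N (span2 u v)])
    (span2 (u *m even_op c t) (v *m even_op c t)).
Proof.
move=> t0 uv; have par := klein_parallel_even_op t0 uv.
have lT : line (span2 (u *m even_op c t) (v *m even_op c t)).
  by apply: span2_line; exact: wedge_op.
have uT : vec (u *m even_op c t) \in span2 (u *m even_op c t) (v *m even_op c t).
  by rewrite memv_span ?inE ?eqxx.
split=> [|N [lN uN Nuv]]; first by split=> //; rewrite -memvE.
apply: (@klein_parallel_unique _ _ (u *m even_op c t)) => //.
  exact: wedge_neq0l (wedge_op t0 uv).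
by rewrite /klein_parallel Nuv.
Qed.

Lemma klein_parallelism : parallelism (klein_parallel (plane_of c)).
Proof.
split=> [M _|M N _ _|L M N _ _ _|p M /pointP[x x0 ->] lM] //; rewrite /klein_parallel //.
  by move=> -> ->.
have [u [v [t [t0 uv -> xE]]]] := klein_parallel_exists lM x0.
exists (span2 (u *m even_op c t) (v *m even_op c t)); rewrite xE.
exact: klein_parallel_line.
Qed.

Definition act (T : 'M[F]_4) : 'End(V) := linfun (vec \o mulmxr T \o coords).

Lemma act_span2 T u v : (act T @: span2 u v)%VS = span2 (u *m T) (v *m T).
Proof. by rewrite limg_span /= !lfunE /= !vecK. Qed.

Lemma klein_parallel_orbit e M N : e != 0 -> line M -> line N ->
  klein_parallel (plane_of c) M N <->
  exists2 x, x != 0 & (act (even_op_to c e x) @: M)%VS = N.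
Proof.
move=> e0 lM lN; split=> [MN|[x x0 <-]].
  have [x [y [xy NE]]] := lineP dimV lN; have x0 := wedge_neq0l xy.
  have [u [v [t [t0 uv ME xE]]]] := klein_parallel_exists lM x0.
  have T1 : e *m even_op c t != 0.
    apply: contra e0 => /eqP eT; apply/eqP.
    by rewrite -[e](mulmxK (even_op_unit aniso_c t0)) eT mul0mx.
  exists (e *m even_op c t) => //; rewrite even_op_to_mul // ME act_span2.
  apply: (@klein_parallel_unique _ _ x) => //.
  - by apply: span2_line; exact: wedge_op.
  - by rewrite xE memv_span ?inE ?eqxx.
  - by rewrite NE memv_span ?inE ?eqxx.
  by rewrite /klein_parallel (klein_parallel_even_op t0 uv) -ME MN.
have [u [v [uv ->]]] := lineP dimV lM; rewrite act_span2 /klein_parallel /even_op_to.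
by rewrite klein_parallel_even_op // even_op_to_coef_neq0.
Qed.
End Plane.

Lemma line_through x z : x != 0 ->
  exists L, [/\ line L, vec x \in L & vec z \in L].
Proof.
move=> x0; have [xz|xz] := eqVneq (wedge x z) 0; last first.
  exists (span2 x z); split; first exact: span2_line.
    by rewrite memv_span ?inE ?eqxx.
  by rewrite memv_span ?inE ?eqxx ?orbT.
have [a ->] := wedge_eq0 xz x0.
have /subvPn[y _ yx] : ~~ ({:V} <= <[vec x]>)%VS.
  by apply/negP => /dimvS; rewrite dimV dim_vline; case: (_ == _).
have xy : wedge x (coords y) != 0.
  apply: contra yx => /eqP/wedge_eq0/(_ x0)[b yb].
  by rewrite -[y](coordsK dimV) yb linearZ memvZ ?memv_line.
exists (span2 x (coords y)); split; first exact: span2_line.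
  by rewrite memv_span ?inE ?eqxx.
by rewrite linearZ memvZ // memv_span ?inE ?eqxx.
Qed.

Section DoubleSpace.
Variables c d : 'M[F]_(3, 6).
Hypotheses (aniso_c : anisotropic c) (aniso_d : anisotropic d).
Hypotheses (cd : perp_planes c d) (dc : perp_planes d c).

Lemma even_op_to_comm e u v :
  even_op_to c e u *m even_op_to d e v = even_op_to d e v *m even_op_to c e u.
Proof. exact: (even_op_comm _ _ aniso_c aniso_d (perp_orthogonal cd)). Qed.

(** With r = p S and q = p T for commuting operators S and T, the image of the line
pq under S and the image of the line pr under T meet in the point q S = r T. *)
Lemma klein_double_space :
  double_space (klein_parallel (plane_of c)) (klein_parallel (plane_of d)).
Proof.
split; [exact: klein_parallelism cd dc | exact: klein_parallelism dc cd |].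
move=> _ _ _ /pointP[x x0 ->] /pointP[y y0 ->] /pointP[z z0 ->] ncol.
have xy : wedge x y != 0.
  apply/eqP => /wedge_eq0/(_ x0)[a yE]; apply: ncol.
  have [L [lL xL zL]] := line_through z x0.
  by exists L; rewrite -!memvE yE linearZ memvZ.
have xz : wedge x z != 0.
  apply/eqP => /wedge_eq0/(_ x0)[a zE]; apply: ncol.
  have [L [lL xL yL]] := line_through y x0.
  by exists L; rewrite -!memvE zE linearZ memvZ.
have span2E u v : (<[vec u]> + <[vec v]>)%VS = span2 u v by rewrite /span2 span_cons span_seq1.
have param b v : anisotropic b -> v != 0 -> exists2 t, t != 0 & v = x *m even_op b t.
  move=> anb v0; exists (v *m invmx (orbit_mx b x)).
    exact: even_op_to_coef_neq0.
  by rewrite -[LHS](mul_even_op_to v anb x0).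
have [t t0 zE] := param c z aniso_c z0; have [s s0 yE] := param d y aniso_d y0.
exists (span2 z (y *m even_op c t)), (span2 y (z *m even_op d s)); rewrite !span2E; split.
- by rewrite {1 2}zE; exact: (klein_parallel_line aniso_c cd dc).
- by rewrite {1 2}yE; exact: (klein_parallel_line aniso_d dc cd).
have e : y *m even_op c t = z *m even_op d s.
  by rewrite yE zE -!mulmxA (even_op_comm _ _ aniso_c aniso_d (perp_orthogonal cd)).
exists <[vec (y *m even_op c t)]>%VS; split.
- apply: point_vec; apply: contra y0 => /eqP yT.
  by rewrite -[y](mulmxK (even_op_unit aniso_c t0)) yT mul0mx.
- by rewrite -memvE memv_span ?inE ?eqxx ?orbT.
by rewrite e -memvE memv_span ?inE ?eqxx ?orbT.
Qed.
End DoubleSpace.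
End KleinParallelism.

(** * The algebra on V *)

Section KleinAlgebra.
Variables (F : fieldType) (V : vectType F).
Hypothesis dimV : \dim {:V} = 4%N.
Local Notation vec := (vec dimV).
Local Notation coords := (coords dimV).
Local Notation plane_of := (plane_of dimV).
Variables c d : 'M[F]_(3, 6).
Hypotheses (aniso_c : anisotropic c) (aniso_d : anisotropic d).
Hypotheses (cd : perp_planes c d) (dc : perp_planes d c).
Variable e : 'rV[F]_4.
Hypothesis e0 : e != 0.
Implicit Types (x y z : V).

(** Left multiplication by x is the even operator of c that maps e to x. *)
Definition klein_mul x y : V := vec (coords y *m even_op_to c e (coords x)).

(** Let L and R be the even operators of c and d that map e to x and to y.  As they
commute, y L = e R L = e L R = x R. *)
Lemma klein_mulE x y : klein_mul x y = vec (coords x *m even_op_to d e (coords y)).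
Proof.
rewrite /klein_mul -[coords y in LHS](mul_even_op_to _ aniso_d e0) -mulmxA.
by rewrite -(even_op_to_comm aniso_c aniso_d cd) mulmxA mul_even_op_to.
Qed.

Lemma klein_mulA : associative klein_mul.
Proof.
move=> x y z; rewrite [klein_mul y z]klein_mulE [RHS]klein_mulE /klein_mul !vecK -!mulmxA.
by rewrite (even_op_to_comm aniso_c aniso_d cd).
Qed.

Lemma klein_mul1l : left_id (vec e) klein_mul.
Proof. by move=> x; rewrite /klein_mul vecK even_op_to_id // mulmx1 coordsK. Qed.

Lemma klein_mul1r : right_id (vec e) klein_mul.
Proof. by move=> x; rewrite klein_mulE vecK even_op_to_id // mulmx1 coordsK. Qed.

Lemma klein_mul_is_linear x : linear (klein_mul x).
Proof.
move=> a y z; rewrite /klein_mul.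
have -> : coords (a *: y + z) = a *: coords y + coords z by exact: linearP.
by rewrite mulmxDl -scalemxAl; exact: linearP.
Qed.

Lemma klein_mul_is_linear_l y : linear (klein_mul^~ y).
Proof.
move=> a x z; rewrite /= /klein_mul.
have -> : coords (a *: x + z) = a *: coords x + coords z by exact: linearP.
have -> u v : even_op_to c e (a *: u + v) = a *: even_op_to c e u + even_op_to c e v.
  exact: linearP.
by rewrite mulmxDr -scalemxAr; exact: linearP.
Qed.

Lemma klein_mulDl : left_distributive klein_mul +%R.
Proof. by move=> x y z; have := klein_mul_is_linear_l z 1 x y; rewrite !scale1r. Qed.

Lemma klein_mulDr : right_distributive klein_mul +%R.
Proof. by move=> x y z; have := klein_mul_is_linear x 1 y z; rewrite !scale1r. Qed.

Lemma klein_mul0l y : klein_mul 0 y = 0.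
Proof. by apply: (addrI (klein_mul 0 y)); rewrite -klein_mulDl !addr0. Qed.

Lemma klein_mul0r x : klein_mul x 0 = 0.
Proof. by apply: (addrI (klein_mul x 0)); rewrite -klein_mulDr !addr0. Qed.

Lemma klein_scaleAl (a : F) x y : a *: klein_mul x y = klein_mul (a *: x) y.
Proof. by have := klein_mul_is_linear_l y a x 0; rewrite klein_mul0l !addr0. Qed.

Lemma klein_scaleAr (a : F) x y : a *: klein_mul x y = klein_mul x (a *: y).
Proof. by have := klein_mul_is_linear x a y 0; rewrite klein_mul0r !addr0. Qed.

Lemma klein_one_neq0 : vec e != 0.
Proof. by rewrite vec_eq0. Qed.

Definition klein_alg : alg_struct V :=
  AlgStruct klein_mulA klein_mul1l klein_mul1r klein_mulDl klein_mulDr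
            klein_scaleAl klein_scaleAr klein_one_neq0.

Local Notation H := (alg_of klein_alg).

Lemma klein_alg_dim : \dim {:H} = 4%N.
Proof. by rewrite -[RHS]dimV !dimvf. Qed.

Lemma coords_eq0 x : (coords x == 0) = (x == 0).
Proof. by rewrite -(inj_eq (can_inj (coordsK dimV))) linear0. Qed.

(** A right inverse of h comes from the left multiplication by h, a left inverse from
the right multiplication; associativity identifies them. *)
Lemma klein_alg_skew : skew_field H.
Proof.
move=> h h0; have ch : coords h != 0 by rewrite coords_eq0.
pose r : H := vec (e *m invmx (even_op_to c e (coords h))).
pose l : H := vec (e *m invmx (even_op_to d e (coords h))).
have hr : h * r = 1.
  by rewrite /GRing.mul /= /klein_mul vecK mulmxKV // even_op_to_unit.
have lh : l * h = 1.
  by rewrite /GRing.mul /= klein_mulE vecK mulmxKV // even_op_to_unit.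
have lr : l = r by rewrite -[l]mulr1 -hr mulrA lh mul1r.
by apply/unitrP; exists r; rewrite -{1}lr.
Qed.

Lemma klein_alg_quadratic : quadratic_algebra H.
Proof.
move=> h; have [t [n qe]] := even_op_quadratic (coords h *m invmx (orbit_mx c e)) aniso_c.
exists t, n; rewrite expr2; change (klein_mul h h = t *: (h : V) + n *: vec e).
rewrite /klein_mul -{1}(mul_even_op_to (coords h) aniso_c e0) -mulmxA qe mulmxDr -scalemxAr.
rewrite -/(even_op_to c e (coords h)) mul_even_op_to // mul_mx_scalar.
by rewrite linearD !linearZ /= coordsK.
Qed.

Lemma klein_alg_condition : condition_A H \/ condition_B H.
Proof.
exact: quadratic_division_algebra klein_alg_skew klein_alg_quadratic klein_alg_dim.
Qed.

Lemma alg_id_ker0 : lker (alg_id klein_alg) == 0%VS.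
Proof. by apply/lker0P => x y; rewrite !alg_idE. Qed.

Lemma amull_act (h : H) M :
  (amull h @: (alg_id klein_alg @: M) =
   alg_id klein_alg @: (act dimV (even_op_to c e (coords h)) @: M))%VS.
Proof.
rewrite -!limg_comp; apply: eq_in_limg => x _.
by rewrite !comp_lfunE !alg_idE !lfunE.
Qed.

Lemma amulr_act (h : H) M :
  (amulr h @: (alg_id klein_alg @: M) =
   alg_id klein_alg @: (act dimV (even_op_to d e (coords h)) @: M))%VS.
Proof.
rewrite -!limg_comp; apply: eq_in_limg => x _.
rewrite !comp_lfunE !alg_idE !lfunE.
exact: klein_mulE.
Qed.

Lemma klein_alg_left M N : line M -> line N ->
  klein_parallel (plane_of c) M N <->
  left_parallel (alg_id klein_alg @: M)%VS (alg_id klein_alg @: N)%VS.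
Proof.
move=> lM lN; apply: iff_trans (klein_parallel_orbit dimV aniso_c cd dc e0 lM lN) _.
split=> [[x x0 MN]|[h h0]].
  exists (vec x : H); first by change (vec x != 0); rewrite vec_eq0.
  by rewrite amull_act vecK MN.
rewrite amull_act => /eqP; rewrite eq_limg_ker0 ?alg_id_ker0 // => /eqP MN.
by exists (coords h) => //; rewrite coords_eq0.
Qed.

Lemma klein_alg_right M N : line M -> line N ->
  klein_parallel (plane_of d) M N <->
  right_parallel (alg_id klein_alg @: M)%VS (alg_id klein_alg @: N)%VS.
Proof.
move=> lM lN; apply: iff_trans (klein_parallel_orbit dimV aniso_d dc cd e0 lM lN) _.
split=> [[x x0 MN]|[h h0]].
  exists (vec x : H); first by change (vec x != 0); rewrite vec_eq0.
  by rewrite amulr_act vecK MN.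
rewrite amulr_act => /eqP; rewrite eq_limg_ker0 ?alg_id_ker0 // => /eqP MN.
by exists (coords h) => //; rewrite coords_eq0.
Qed.
End KleinAlgebra.

(** * The theorem *)

Theorem theorem4p8 (F : fieldType) (V : vectType F)
    (C : {vspace exterior V}) :
  \dim {:V} = 4%N -> (C <= ext_pow V 2)%VS -> plane C -> external C ->
  [/\ plane (polar C), external (polar C),
      double_space (klein_parallel C) (klein_parallel (polar C))
    & exists S : alg_struct V,
      [/\ condition_A (alg_of S) \/ condition_B (alg_of S),
          forall M N : {vspace V}, line M -> line N ->
            klein_parallel C M N <->
            left_parallel (alg_id S @: M)%VS (alg_id S @: N)%VS
        & forall M N : {vspace V}, line M -> line N ->
            klein_parallel (polar C) M N <->
            right_parallel (alg_id S @: M)%VS (alg_id S @: N)%VS]].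
Proof.
move=> dimV sC dC extC; have [c fc CE] := plane_of_surj dimV sC dC.
have [d fd cd] := perp_exists fc; have dc := perp_planes_sym fc fd cd.
rewrite CE (polar_plane_of _ cd) in extC *.
have aniso_c : anisotropic c by apply/(externalP dimV fc).
have aniso_d : anisotropic d := perp_anisotropic fd aniso_c (perp_orthogonal cd).
have e0 : (delta_mx 0 0 : 'rV[F]_4) != 0.
  by apply/rV0Pn; exists 0; rewrite mxE !eqxx oner_eq0.
split; [exact: dim_plane_of | exact/externalP | exact: klein_double_space |].
exists (klein_alg dimV aniso_c aniso_d cd e0); split.
- exact: klein_alg_condition.
- exact: klein_alg_left.
exact: klein_alg_right.
Qed.
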